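(* Let $(Z_i^{(1)})_{i\ge1}$ and $(Z_i^{(2)})_{i\ge1}$ be two mutually independent sequences, each consisting of i.i.d. random vectors in $\mathbb{R}^2$ (the two laws may differ), with $\mathbb{E}[\|Z_1^{(k)}\|^2]<\infty$ for $k=1,2$. Assume that $\boldsymbol{0}\notin\{\boldsymbol{\mu}^{(1)},\boldsymbol{\mu}^{(2)},\boldsymbol{\mu}^{(1)}-\boldsymbol{\mu}^{(2)}\}$ and that $\|\boldsymbol{\mu}^{(1)}\|$ is the unique maximal element among $\|\boldsymbol{\mu}^{(1)}\|,\|\boldsymbol{\mu}^{(2)}\|,\|\boldsymbol{\mu}^{(1)}-\boldsymbol{\mu}^{(2)}\|$, i.e. $\|\boldsymbol{\mu}^{(1)}\|>\max\{\|\boldsymbol{\mu}^{(2)}\|,\|\boldsymbol{\mu}^{(1)}-\boldsymbol{\mu}^{(2)}\|\}$. Then $$\lim_{n\to\infty}\frac{\mathrm{Var}[D_n]}{n}=\sigma_D^2\in[0,\infty),\qquad\text{where}\qquad \sigma_D^2=\mathbb{E}\left[\left((Z_1^{(1)}-\boldsymbol{\mu}^{(1)})\cdot\mathbf{e}_{\theta^{(1)}}\right)^2\right].$$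
   Context: $\boldsymbol{\mu}^{(k)}=\mathbb{E}[Z_1^{(k)}]$, $S_0^{(k)}=0$, $S_n^{(k)}=\sum_{i=1}^n Z_i^{(k)}$ for $k=1,2$. $D_n$ is the diameter of the convex hull of $\{S_j^{(k)}:0\le j\le n,\ k=1,2\}$. $\mathbf{e}_\theta=(\cos\theta,\sin\theta)$, and $\theta^{(1)}\in[0,2\pi)$ is given by $\boldsymbol{\mu}^{(1)}=\|\boldsymbol{\mu}^{(1)}\|\,\mathbf{e}_{\theta^{(1)}}$. Here $\cdot$ is the Euclidean scalar product and $\|\cdot\|$ the Euclidean norm. *)

(* Defs.v *)
(* The plane is [R * R] for an arbitrary [R : realType]; its
   measurable sets are the Borel ones, and its library norm is the sup norm, so
   the Euclidean norm is defined here. *)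
From HB Require Import structures.
From mathcomp Require Import all_boot all_order all_algebra.
From mathcomp Require Import finmap.
From mathcomp Require Import all_classical all_reals all_analysis.

Set Implicit Arguments.
Unset Strict Implicit.
Unset Printing Implicit Defensive.

Import Order.TTheory GRing.Theory Num.Theory.
Import numFieldNormedType.Exports.

Local Open Scope classical_set_scope.
Local Open Scope ring_scope.

Section plane.
Context {R : realType}.
Implicit Types (x y : R * R) (A : set (R * R)).

Definition dot x y : R := x.1 * y.1 + x.2 * y.2.

Definition enorm x : R := Num.sqrt (dot x x).

Definition unit_vector (theta : R) : R * R := (cos theta, sin theta).

Definition convex_hull A : set (R * R) :=
  smallest (@convex_set R (R * R)%type) A.

(* [sup] is 0 on sets that are empty or unbounded above; it is only used on
   hulls of nonempty finite sets. *)
Definition diameter A : R :=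
  sup [set enorm (p.1 - p.2) | p in A `*` A].

End plane.

Section independence.
Context {d d' : measure_display} {T : measurableType d}
  {T' : measurableType d'} {R : realType} (P : probability T R).

Definition mutually_independent (I : choiceType) (X : I -> {RV P >-> T'}) :=
  forall (J : {fset I}) (B : I -> set T'), (forall i, measurable (B i)) ->
    P (\bigcap_(i in [set` J]) X i @^-1` B i) =
    (\prod_(i <- J) fine (P (X i @^-1` B i)))%:E.

(* Laws are compared on measurable sets only: the value of a measure on other
   sets is unconstrained. *)
Definition identically_distributed (I : Type) (X : I -> {RV P >-> T'}) :=
  forall i j (B : set T'), measurable B ->
    distribution P (X i) B = distribution P (X j) B.

Definition iid (I : choiceType) (X : I -> {RV P >-> T'}) :=
  mutually_independent X /\ identically_distributed X.

Definition generated_sigma_algebra (I : Type) (X : I -> {RV P >-> T'}) :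
    set (set T) :=
  <<s \bigcup_i preimage_set_system [set: T] (X i) measurable >>.

Definition independent_families (I : Type) (X Y : I -> {RV P >-> T'}) :=
  forall A B, generated_sigma_algebra X A -> generated_sigma_algebra Y B ->
    P (A `&` B) = (P A * P B)%E.

End independence.

Section random_walks.
Context {d : measure_display} {T : measurableType d} {R : realType}
  (P : probability T R).
Implicit Types (X : {RV P >-> (R * R)%type})
  (Z : nat -> {RV P >-> (R * R)%type}).

Definition mean X : R * R :=
  (fine 'E_P[fst \o X], fine 'E_P[snd \o X]).

(* Increments are numbered from 0: [Z i] is the increment of step [i.+1]. *)
Definition walk Z (n : nat) (w : T) : R * R := \sum_(i < n) Z i w.

Definition walk_points Z (n : nat) (w : T) : set (R * R) :=
  [set walk Z j w | j in [set j | (j <= n)%N]].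

Definition hull_diameter (Z1 Z2 : nat -> {RV P >-> (R * R)%type})
    (n : nat) (w : T) : R :=
  diameter (convex_hull (walk_points Z1 n w `|` walk_points Z2 n w)).

End random_walks.

(* Main.v *)
(* Let e be the direction of mu1, S and T the two walks and
   Delta_n = D_n - S_n . e, which is nonnegative since D_n >= |S_n|. The
   variance of S_n . e is n sigma^2, so it suffices that E[Delta_n^2] = o(n).

   Let L_n be the largest deviation of the two walks from their drifts up to
   time n. Always Delta_n <= 3 L_n. When L_n <= eps n, two points of the walks
   that are not within r = delta n steps of S_n and of the origin are too close
   to realize the diameter, and the convexity of the norm gives
   Delta_n <= L_r + 2 L'_r + (eps / |mu1|) L_n, where L'_r is the deviation of
   the last r steps.

   The second moments of these maxima are linear in the number of steps by the
   pathwise form of Doob's inequality,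
     max_{k <= n} s_k^2 <= 4 sum_k x_k^2
                           + 4 sum_k (2 s_k - max_{j <= k} s_j) x_k,
   whose last sum is a martingale with variance O(n^2). The same inequality
   shows that L_n^2 / n is uniformly integrable, which disposes of the event
   L_n > eps n, of probability O(1/n). No moments above the second are
   needed. *)
Require Import Defs.
From HB Require Import structures.
From mathcomp Require Import all_boot all_order all_algebra.
From mathcomp Require Import finmap.
From mathcomp Require Import all_classical all_reals all_analysis.
From mathcomp Require Import measurable_realfun zify ring lra.

Set Implicit Arguments.
Unset Strict Implicit.
Unset Printing Implicit Defensive.

Import Order.TTheory GRing.Theory Num.Theory.
Import numFieldNormedType.Exports.

Local Open Scope classical_set_scope.
Local Open Scope ring_scope.

(** * Integrability *)

Section integrability.
Context {d : measure_display} {T : measurableType d} {R : realType}.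
Variable P : probability T R.
Implicit Types f g : T -> R.

(** An infinite integral is read as 0 here, which is why most rules below ask for integrability. *)
Definition mean_real f : R := \int[P]_w f w.

Definition integrable1 f := P.-integrable setT (EFin \o f).

Definition integrable2 f :=
  measurable_fun setT f /\ integrable1 (fun w => f w ^+ 2).

Lemma integrable1_measurable f : integrable1 f -> measurable_fun setT f.
Proof. by move=> /integrableP[/measurable_EFinP]. Qed.

Lemma integrable1_le f g : measurable_fun setT f -> integrable1 g ->
  (forall w, `|f w| <= g w) -> integrable1 f.
Proof.
move=> mf ig fg; apply: (le_integrable _ _ _ ig) => //.
  exact/measurable_EFinP.
by move=> w _ /=; rewrite lee_fin (le_trans (fg w))// ler_norm.
Qed.

Lemma integrable1_cst r : integrable1 (fun=> r).
Proof.
apply/integrableP; split; first exact/measurable_EFinP/measurable_cst.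
by rewrite integral_cst//= probability_setT mule1 ltry.
Qed.

Lemma integrable1D f g : integrable1 f -> integrable1 g ->
  integrable1 (fun w => f w + g w).
Proof. by move=> i1 i2; apply: eq_integrable (integrableD _ i1 i2) => //. Qed.

Lemma integrable1Z r f : integrable1 f -> integrable1 (fun w => r * f w).
Proof. by move=> i1; apply: eq_integrable (integrableZl _ r i1) => //. Qed.

Lemma integrable1N f : integrable1 f -> integrable1 (fun w => - f w).
Proof.
move=> i1; have := integrable1Z (-1) i1.
by apply: eq_integrable => // w _ /=; rewrite mulN1r.
Qed.

Lemma integrable1B f g : integrable1 f -> integrable1 g ->
  integrable1 (fun w => f w - g w).
Proof. by move=> i1 i2; apply: integrable1D => //; exact: integrable1N. Qed.

Lemma integrable1_sum (F : nat -> T -> R) n :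
  (forall i, (i < n)%N -> integrable1 (F i)) ->
  integrable1 (fun w => \sum_(i < n) F i w).
Proof.
elim: n => [|n IH] iF.
  by under eq_fun do rewrite big_ord0; exact: integrable1_cst.
under eq_fun do rewrite big_ord_recr.
by apply: integrable1D; [apply: IH => i /ltnW/iF | exact: iF].
Qed.

Lemma integrable1_indic f (A : set T) : measurable A -> integrable1 f ->
  integrable1 (fun w => f w * \1_A w).
Proof.
move=> mA i1; have i1' : integrable1 (fun w => `|f w|).
  exact: eq_integrable (integrable_abse i1).
apply: integrable1_le i1' _.
  by apply: measurable_funM => //; exact: integrable1_measurable.
move=> w; rewrite normrM -[leRHS]mulr1 ler_wpM2l//.
by rewrite indicE; case: (_ \in _); rewrite ?normr0 ?normr1.
Qed.

Lemma mean_real_cst r : mean_real (fun=> r) = r.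
Proof. by rewrite /mean_real Rintegral_cst//= probability_setT mulr1. Qed.

Lemma mean_realD f g : integrable1 f -> integrable1 g ->
  mean_real (fun w => f w + g w) = mean_real f + mean_real g.
Proof. by move=> i1 i2; rewrite /mean_real RintegralD. Qed.

Lemma mean_realB f g : integrable1 f -> integrable1 g ->
  mean_real (fun w => f w - g w) = mean_real f - mean_real g.
Proof. by move=> i1 i2; rewrite /mean_real RintegralB. Qed.

Lemma mean_realZ r f : integrable1 f ->
  mean_real (fun w => r * f w) = r * mean_real f.
Proof. by move=> i1; rewrite /mean_real RintegralZl. Qed.

Lemma mean_real_sum (F : nat -> T -> R) n :
  (forall i, (i < n)%N -> integrable1 (F i)) ->
  mean_real (fun w => \sum_(i < n) F i w) = \sum_(i < n) mean_real (F i).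
Proof.
elim: n => [|n IH] iF.
  by under eq_fun do rewrite big_ord0; rewrite big_ord0 mean_real_cst.
rewrite big_ord_recr /= -IH; last by move=> i /ltnW/iF.
rewrite -mean_realD; last 2 first.
- by apply: integrable1_sum => i /ltnW/iF.
- exact: iF.
by congr mean_real; apply/funext => w; rewrite big_ord_recr.
Qed.

Lemma mean_real_le f g : integrable1 f -> integrable1 g ->
  (forall w, f w <= g w) -> mean_real f <= mean_real g.
Proof. by move=> i1 i2 fg; apply: le_Rintegral. Qed.

Lemma mean_real_ge0 f : (forall w, 0 <= f w) -> 0 <= mean_real f.
Proof. by move=> f0; apply: Rintegral_ge0. Qed.

Lemma mean_real_indic (A : set T) : measurable A ->
  mean_real (\1_A) = fine (P A).
Proof. by move=> mA; rewrite /mean_real /Rintegral integral_indic// setIT. Qed.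

Lemma mean_realE f : integrable1 f -> (\int[P]_w (f w)%:E)%E = (mean_real f)%:E.
Proof. by move=> i1; rewrite /mean_real /Rintegral fineK// integrable_fin_num. Qed.

Lemma ge0_integrable1 f : measurable_fun setT f -> (forall w, 0 <= f w) ->
  (\int[P]_w (f w)%:E < +oo)%E -> integrable1 f.
Proof.
move=> mf f0 foo; apply/integrableP; split; first exact/measurable_EFinP.
by under eq_integral do rewrite /= ger0_norm//.
Qed.

Lemma integrable2_le f g : measurable_fun setT f -> integrable2 g ->
  (forall w, `|f w| <= g w) -> integrable2 f.
Proof.
move=> mf [mg i2] fg; split => //.
apply: integrable1_le i2 _; first exact: measurable_funX.
by move=> w; rewrite normrX lerXn2r// ?nnegrE// (le_trans _ (fg w)).
Qed.

Lemma integrable2_cst r : integrable2 (fun=> r).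
Proof. by split; [exact: measurable_cst | exact: integrable1_cst]. Qed.

Lemma integrable2M f g : integrable2 f -> integrable2 g ->
  integrable1 (fun w => f w * g w).
Proof.
move=> [mf i1] [mg i2]; apply: integrable1_le (integrable1D i1 i2) _.
  exact: measurable_funM.
move=> w; rewrite ler_norml; apply/andP; split; nra.
Qed.

Lemma integrable2D f g : integrable2 f -> integrable2 g ->
  integrable2 (fun w => f w + g w).
Proof.
move=> i1 i2; have := integrable1Z 2 (integrable2M i1 i2).
case: i1 i2 => [mf i1] [mg i2] i12; split; first exact: measurable_funD.
under eq_fun do rewrite sqrrD.
apply: integrable1D => //; apply: integrable1D => //.
by apply: eq_integrable i12 => // w _ /=; rewrite mulr2n mulrDl mul1r.
Qed.

Lemma integrable2Z r f : integrable2 f -> integrable2 (fun w => r * f w).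
Proof.
move=> [mf i1]; split; first exact: measurable_funM.
by under eq_fun do rewrite exprMn; exact: integrable1Z.
Qed.

Lemma integrable2N f : integrable2 f -> integrable2 (fun w => - f w).
Proof.
move=> [mf i1]; split; first exact: measurableT_comp.
by under eq_fun do rewrite sqrrN.
Qed.

Lemma integrable2B f g : integrable2 f -> integrable2 g ->
  integrable2 (fun w => f w - g w).
Proof. by move=> i1 i2; apply: integrable2D => //; exact: integrable2N. Qed.

Lemma integrable2_1 f : integrable2 f -> integrable1 f.
Proof.
move=> i2; have := integrable2M i2 (integrable2_cst 1).
by apply: eq_integrable => // w _; rewrite /= mulr1.
Qed.

Lemma integrable2_sum (F : nat -> T -> R) n :
  (forall i, (i < n)%N -> integrable2 (F i)) ->
  integrable2 (fun w => \sum_(i < n) F i w).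
Proof.
elim: n => [|n IH] iF.
  by under eq_fun do rewrite big_ord0; exact: integrable2_cst.
under eq_fun do rewrite big_ord_recr.
by apply: integrable2D; [apply: IH => i /ltnW/iF | exact: iF].
Qed.

Lemma integrable2_max f g : integrable2 f -> integrable2 g ->
  integrable2 (fun w => Num.max (f w) (g w)).
Proof.
move=> [mf i1] [mg i2]; have mfg := measurable_maxr mf mg; split => //.
apply: integrable1_le (integrable1D i1 i2) _; first exact: measurable_funX.
move=> w; rewrite ger0_norm ?sqr_ge0//.
by case: (leP (f w) (g w)) => _; rewrite ?lerDl ?lerDr ?sqr_ge0.
Qed.

End integrability.

(** * Independence *)

Section independence.
Context {d : measure_display} {T : measurableType d} {R : realType}.
Variable P : probability T R.

Definition independent_rv (X Y : T -> R) :=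
  forall A B, measurable A -> measurable B ->
    P (X @^-1` A `&` Y @^-1` B) = (P (X @^-1` A) * P (Y @^-1` B))%E.

Lemma independent_rv_comp (X Y : T -> R) (f g : R -> R) :
  measurable_fun setT f -> measurable_fun setT g ->
  independent_rv X Y -> independent_rv (f \o X) (g \o Y).
Proof.
move=> mf mg XY A B mA mB; apply: (XY (f @^-1` A) (g @^-1` B)).
  by rewrite -[X in measurable X]setTI; exact: mf.
by rewrite -[X in measurable X]setTI; exact: mg.
Qed.

(** Independence identifies the joint law with the product of the marginal laws, by uniqueness of
    the product measure on rectangles; Tonelli then factors the integral. *)
Lemma ge0_independent_integral (X Y : {RV P >-> R}) :
  independent_rv X Y -> (forall w, 0 <= X w) -> (forall w, 0 <= Y w) ->
  (\int[P]_w (X w * Y w)%:E = \int[P]_w (X w)%:E * \int[P]_w (Y w)%:E)%E.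
Proof.
move=> XY X0 Y0.
have mXY : measurable_fun setT (fun w => (X w, Y w)).
  by apply/measurable_fun_pairP; split.
pose m1 : {mfun T >-> (R * R)%type} :=
  HB.pack (fun w => (X w, Y w)) (isMeasurableFun.Build _ _ _ _ _ mXY).
(* The absolute values make [f] nonnegative on the whole plane, as Tonelli requires, and change
   nothing on the range of [(X, Y)]. *)
pose f (p : R * R) : \bar R := (`|p.1| * `|p.2|)%:E.
have mf : measurable_fun setT f.
  by apply/measurable_EFinP; apply: measurable_funM; apply: measurableT_comp.
have -> : (\int[P]_w (X w * Y w)%:E = \int[distribution P m1]_p f p)%E.
  rewrite ge0_integral_distribution//.
    by apply: eq_integral => w _; rewrite /f/= !ger0_norm.
  by move=> p; rewrite lee_fin mulr_ge0.
have -> : (\int[distribution P m1]_p f p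
    = \int[(distribution P X \x distribution P Y)%E]_p f p)%E.
  apply: eq_measure_integral => A mA _; apply/esym.
  by apply: product_measure_unique => // B C mB mC; exact: XY.
have mn : measurable_fun setT (fun x : R => `|x|%:E).
  by apply/measurable_EFinP.
rewrite fubini_tonelli1//; last by move=> p; rewrite lee_fin mulr_ge0.
rewrite /fubini_F.
under eq_integral => x _ do under eq_integral => y _ do rewrite /f /= EFinM.
under eq_integral => x _ do rewrite ge0_integralZl//.
rewrite ge0_integralZr//; last exact: integral_ge0.
rewrite !ge0_integral_distribution//.
by congr (_ * _)%E; apply: eq_integral => w _; rewrite /= ger0_norm.
Qed.

Lemma ge0_independentM (X Y : T -> R) :
  integrable1 P X -> integrable1 P Y -> independent_rv X Y ->
  (forall w, 0 <= X w) -> (forall w, 0 <= Y w) ->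
  integrable1 P (fun w => X w * Y w) /\
  mean_real P (fun w => X w * Y w) = mean_real P X * mean_real P Y.
Proof.
move=> iX iY XY X0 Y0.
have mX := integrable1_measurable iX; have mY := integrable1_measurable iY.
pose X' : {mfun T >-> R} := HB.pack X (isMeasurableFun.Build _ _ _ _ _ mX).
pose Y' : {mfun T >-> R} := HB.pack Y (isMeasurableFun.Build _ _ _ _ _ mY).
have E := @ge0_independent_integral X' Y' XY X0 Y0.
rewrite /= (mean_realE iX) (mean_realE iY) in E.
have i1 : integrable1 P (fun w => X w * Y w).
  apply: ge0_integrable1; first exact: measurable_funM.
    by move=> w; rewrite mulr_ge0.
  by rewrite E -EFinM ltry.
split => //; move: E; rewrite mean_realE// -EFinM.
by case.
Qed.

(** Positive and negative parts are functions of [X] and of [Y], so each of the four pairs is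
    independent and the nonnegative case applies; bilinearity reassembles the product. *)
Lemma independentM (X Y : T -> R) :
  integrable1 P X -> integrable1 P Y -> independent_rv X Y ->
  integrable1 P (fun w => X w * Y w) /\
  mean_real P (fun w => X w * Y w) = mean_real P X * mean_real P Y.
Proof.
move=> iX iY XY.
pose p (x : R) := Num.max x 0; pose q (x : R) := Num.max (- x) 0.
have mp : measurable_fun setT p by exact: measurable_maxr.
have mq : measurable_fun setT q by apply: measurable_maxr.
have p0 x : 0 <= p x by rewrite /p le_max lexx orbT.
have q0 x : 0 <= q x by rewrite /q le_max lexx orbT.
have pq x : x = p x - q x.
  rewrite /p /q; case: (leP x 0) => x0; case: (leP (- x) 0) => x1; lra.
have ip Z : integrable1 P Z -> integrable1 P (p \o Z).
  move=> iZ; have iZ' : integrable1 P (fun w => `|Z w|).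
    exact: eq_integrable (integrable_abse iZ).
  apply: integrable1_le iZ' _.
    exact/measurableT_comp/(integrable1_measurable iZ).
  move=> w; rewrite ger0_norm//= /p ge_max normr_ge0 andbT; exact: ler_norm.
have iq Z : integrable1 P Z -> integrable1 P (q \o Z).
  by move=> iZ; apply: (ip (fun w => - Z w)); exact: integrable1N.
have [i1 e1] := ge0_independentM (ip _ iX) (ip _ iY)
  (independent_rv_comp mp mp XY) (fun=> p0 _) (fun=> p0 _).
have [i2 e2] := ge0_independentM (ip _ iX) (iq _ iY)
  (independent_rv_comp mp mq XY) (fun=> p0 _) (fun=> q0 _).
have [i3 e3] := ge0_independentM (iq _ iX) (ip _ iY)
  (independent_rv_comp mq mp XY) (fun=> q0 _) (fun=> p0 _).
have [i4 e4] := ge0_independentM (iq _ iX) (iq _ iY)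
  (independent_rv_comp mq mq XY) (fun=> q0 _) (fun=> q0 _).
have dX : X = (fun w => (p \o X) w - (q \o X) w) by apply/funext => w; exact: pq.
have dY : Y = (fun w => (p \o Y) w - (q \o Y) w) by apply/funext => w; exact: pq.
have -> : (fun w => X w * Y w) = (fun w =>
    ((p \o X) w * (p \o Y) w - (p \o X) w * (q \o Y) w) -
    ((q \o X) w * (p \o Y) w - (q \o X) w * (q \o Y) w)).
  by apply/funext => w; rewrite {1}dX {1}dY /=; ring.
split; first by apply: integrable1B; exact: integrable1B.
rewrite mean_realB; [|exact: integrable1B|exact: integrable1B].
rewrite !mean_realB// e1 e2 e3 e4 {5}dX {5}dY.
rewrite !mean_realB; [ring|..]; first [exact: ip | exact: iq].
Qed.

End independence.

(** * Martingale transforms *)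

Section adapted_processes.
Context {d : measure_display} {T : measurableType d} {R : realType}.
Variables (P : probability T R) (x : nat -> T -> R).

(** The product formula over initial segments yields the one over any finite set of indices, by
    taking [setT] for the remaining [B i]. *)
Record centered_iid := CenteredIid {
  centered_iid_measurable : forall i, measurable_fun setT (x i);
  centered_iid_independent : forall n (B : nat -> set R),
    (forall i, measurable (B i)) ->
    P (\bigcap_(i in `I_n) x i @^-1` B i) =
    (\prod_(i < n) fine (P (x i @^-1` B i)))%:E;
  centered_iid_law : forall i B, measurable B ->
    P (x i @^-1` B) = P (x 0%N @^-1` B);
  centered_iid_integrable2 : integrable2 P (x 0%N);
  centered_iid_mean : mean_real P (x 0%N) = 0 }.

(** These cylinders form a pi-system, and [<<s past n >>] is the sigma-algebra of the first [n]
    steps. Since [x n] is the first step outside it, [adapted n] means predictable with respect to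
    [x n]. *)
Definition past (n : nat) : set (set T) :=
  [set A | exists2 B : nat -> set R, (forall i, measurable (B i)) &
    A = \bigcap_(i in `I_n) x i @^-1` B i].

Definition adapted (n : nat) (H : T -> R) :=
  @measurable_fun _ _ (g_sigma_algebraType (past n)) R setT H.

Hypothesis xP : centered_iid.

Let measurable_preimage i B : measurable B -> measurable (x i @^-1` B).
Proof.
by move=> mB; rewrite -[X in measurable X]setTI; exact: centered_iid_measurable.
Qed.

Lemma past_measurable n : <<s past n >> `<=` measurable.
Proof.
apply: smallest_sub; first exact: sigma_algebra_measurable.
move=> _ [B mB ->]; apply: bigcap_measurableType => i _.
exact: measurable_preimage.
Qed.

Lemma past_setI_closed n : setI_closed (past n).
Proof.
move=> _ _ [B mB ->] [C mC ->]; exists (fun i => B i `&` C i).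
  by move=> i; exact: measurableI.
by rewrite -bigcapI; apply: eq_bigcapr => i _.
Qed.

Lemma past_independent n A B : <<s past n >> A -> measurable B ->
  P (A `&` x n @^-1` B) = (P A * P (x n @^-1` B))%E.
Proof.
move=> pA mB; have mxB := measurable_preimage n mB; move: A pA.
pose Q (A : set T) := P (A `&` x n @^-1` B) = (P A * P (x n @^-1` B))%E.
have QG C : past n C -> Q C.
  move=> [D mD ->].
  pose D' i := if (i < n)%N then D i else B.
  have mD' i : measurable (D' i) by rewrite /D'; case: ifP.
  have := centered_iid_independent xP n.+1 mD'.
  have -> : \bigcap_(i in `I_n.+1) x i @^-1` D' i =
      (\bigcap_(i in `I_n) x i @^-1` D i) `&` x n @^-1` B.
    apply/seteqP; split => w /=.
      move=> h; split.
        by move=> i /= ni; have := h i (ltnW ni); rewrite /= /D' ni.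
      by have := h n (ltnSn n); rewrite /= /D' ltnn.
    move=> [h1 h2] i /=; rewrite ltnS leq_eqVlt /D' => /orP[/eqP ->|ni].
      by rewrite ltnn.
    by rewrite ni; exact: h1.
  rewrite /Q => ->; rewrite big_ord_recr /= {2}/D' ltnn EFinM.
  rewrite fineK ?fin_num_measure//.
  rewrite centered_iid_independent//; congr (_ %:E * _)%E.
  by apply: eq_bigr => i _; rewrite /D' ltn_ord.
have QC A : measurable A -> Q A -> Q (~` A).
  rewrite /Q => mA QA; rewrite setIC -setDE.
  have -> : P (x n @^-1` B `\` A) = (P (x n @^-1` B) - P (A `&` x n @^-1` B))%E.
    by rewrite measureD// 1?setIC// -ge0_fin_numE ?fin_num_measure.
  rewrite QA probability_setC// muleBl ?mul1e ?fin_num_measure//.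
have QU F : (forall i : nat, measurable (F i)) -> trivIset setT F ->
    (forall i, Q (F i)) -> Q (\bigcup_i F i).
  rewrite /Q => mF tF QF.
  have -> : P ((\bigcup_i F i) `&` x n @^-1` B) =
      (\sum_(i <oo) P (x n @^-1` B) * P (F i))%E.
    rewrite setI_bigcupl measure_semi_bigcup//.
    - by apply: eq_eseriesr => i _; rewrite muleC; exact: QF.
    - by move=> i; exact: measurableI.
    - exact: trivIset_setIr.
    - by apply: bigcup_measurable => i _; exact: measurableI.
  have -> : P (\bigcup_i F i) = (\sum_(i <oo) P (F i))%E.
    by rewrite measure_semi_bigcup//; exact: bigcup_measurable.
  by rewrite -[P (_ @^-1` _)]fineK ?fin_num_measure// nneseriesZl// muleC.
apply: (@dynkin_induction _ (g_sigma_algebraType (past n)) (past n) Q) => //.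
- exact: past_setI_closed.
- by rewrite /Q setTI probability_setT mul1e.
- by move=> A pA; apply: QC; exact: (@past_measurable n _ pA).
- by move=> F pF; apply: QU => i; exact: (@past_measurable n _ (pF i)).
Qed.

Lemma adapted_independent n H : adapted n H -> independent_rv P H (x n).
Proof.
move=> aH A B mA mB; apply: past_independent => //.
by rewrite -[_ @^-1` _]setTI; exact: aH.
Qed.

Lemma past_sub m n : (m <= n)%N -> past m `<=` past n.
Proof.
move=> mn _ [B mB ->]; exists (fun i => if (i < m)%N then B i else setT).
  by move=> i; case: ifP.
apply/seteqP; split => w h i /= ni.
  by case: ifPn => // im; exact: h.
by have := h i (leq_trans ni mn); rewrite /= ni.
Qed.

Lemma adapted_le m n H : (m <= n)%N -> adapted m H -> adapted n H.
Proof.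
move=> mn aH _ B mB; have := aH measurableT B mB.
apply: sub_sigma_algebra2; exact: past_sub.
Qed.

Lemma adapted_step n : adapted n.+1 (x n).
Proof.
move=> _ B mB; apply: sub_sigma_algebra.
exists (fun i => if i == n then B else setT); first by move=> i; case: ifP.
rewrite setTI; apply/seteqP; split => w.
  by move=> h i _ /=; case: eqP => [->|].
by move=> /(_ n (ltnSn n)) /=; rewrite eqxx.
Qed.

End adapted_processes.

Section martingale_transform.
Context {d : measure_display} {T : measurableType d} {R : realType}.
Variables (P : probability T R) (x : nat -> T -> R).
Hypothesis xP : centered_iid P x.

(** Both means are integrals of [f] against the law of a step, and these laws agree on measurable
    sets. *)
Lemma centered_iid_transfer (f : R -> R) i : measurable_fun setT f ->
  integrable1 P (f \o x 0%N) ->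
  integrable1 P (f \o x i) /\ mean_real P (f \o x i) = mean_real P (f \o x 0%N).
Proof.
move=> mf i0; have mx := centered_iid_measurable xP.
pose X j : {mfun T >-> R} := HB.pack (x j) (isMeasurableFun.Build _ _ _ _ _ (mx j)).
have eqX g : (\int[distribution P (X i)]_y g y =
              \int[distribution P (X 0%N)]_y g y)%E.
  by apply: eq_measure_integral => A mA _; exact: (centered_iid_law xP i mA).
have mEf : measurable_fun setT (fun y => (f y)%:E) by exact/measurable_EFinP.
have ii : integrable1 P (f \o x i).
  apply/integrableP; split.
    by apply/measurable_EFinP; exact: measurableT_comp.
  have := eqX (fun y => `|(f y)%:E|%E).
  rewrite !ge0_integral_distribution//; last 2 first.
    by apply/measurableT_comp.
    by apply/measurableT_comp.
  by move=> /= ->; case/integrableP : i0.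
split => //; have := eqX (fun y => (f y)%:E).
rewrite (integral_distribution (X := X i) mEf ii).
rewrite (integral_distribution (X := X 0%N) mEf i0) => e; exact: (congr1 fine e).
Qed.

Let measurable_sqr : measurable_fun setT (fun y : R => y ^+ 2).
Proof. exact: exprn_measurable. Qed.

Lemma integrable2_step i : integrable2 P (x i).
Proof.
split; first exact: (centered_iid_measurable xP).
have [_ ix] := centered_iid_integrable2 xP.
by have [] := @centered_iid_transfer _ i measurable_sqr ix.
Qed.

Lemma mean_step i : mean_real P (x i) = 0.
Proof.
have ix := integrable2_1 (centered_iid_integrable2 xP).
have [_ e] := @centered_iid_transfer id i (@measurable_id _ _ _) ix.
exact: etrans e (centered_iid_mean xP).
Qed.

Definition step_variance := mean_real P (fun w => x 0%N w ^+ 2).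

Lemma step_variance_ge0 : 0 <= step_variance.
Proof. by apply: mean_real_ge0 => w; exact: sqr_ge0. Qed.

Lemma mean_step_sqr i : mean_real P (fun w => x i w ^+ 2) = step_variance.
Proof.
have [_ ix] := centered_iid_integrable2 xP.
by have [] := @centered_iid_transfer _ i measurable_sqr ix.
Qed.

(** [H] depends on earlier steps only, so [H ^+ 2] and [x n ^+ 2] are independent and the second
    moment of the product factors. Fourth moments are thereby avoided. *)
Lemma adapted_mul_step n H : adapted x n H -> integrable2 P H ->
  integrable2 P (fun w => H w * x n w) /\
  mean_real P (fun w => (H w * x n w) ^+ 2) =
    mean_real P (fun w => H w ^+ 2) * step_variance.
Proof.
move=> aH iH; have indep := adapted_independent xP aH.
have ix := integrable2_step n.
have [] := independentM (X := fun w => H w ^+ 2) (Y := fun w => x n w ^+ 2)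
  (proj2 iH) (proj2 ix) (independent_rv_comp measurable_sqr measurable_sqr indep).
have -> : (fun w => H w ^+ 2 * x n w ^+ 2) = (fun w => (H w * x n w) ^+ 2).
  by apply/funext => w; rewrite exprMn.
rewrite mean_step_sqr => i1 e1; split => //; split => //.
by apply: measurable_funM; [case: iH | case: ix].
Qed.

Lemma mean_adapted_step n H : adapted x n H -> integrable1 P H ->
  integrable1 P (fun w => H w * x n w) /\ mean_real P (fun w => H w * x n w) = 0.
Proof.
move=> aH iH; have ix := integrable2_1 (integrable2_step n).
have [i1 ->] := independentM iH ix (adapted_independent xP aH).
by split=> //; rewrite mean_step mulr0.
Qed.

Definition transform (H : nat -> T -> R) n w := \sum_(k < n) H k w * x k w.

Variable H : nat -> T -> R.
Hypothesis adaptedH : forall k, adapted x k (H k).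
Hypothesis integrable2H : forall k, integrable2 P (H k).

Lemma transform_adapted n : adapted x n (transform H n).
Proof.
rewrite /adapted; elim: n => [|n IH].
  have -> : transform H 0 = (fun=> 0).
    by apply/funext => w; rewrite /transform big_ord0.
  exact: measurable_cst.
have -> : transform H n.+1 = (fun w => transform H n w + H n w * x n w).
  by apply/funext => w; rewrite /transform big_ord_recr.
apply: measurable_funD; first exact: (adapted_le (leqnSn n) IH).
apply: measurable_funM; first exact: (adapted_le (leqnSn n) (@adaptedH n)).
exact: adapted_step.
Qed.

Lemma transform_integrable2 n : integrable2 P (transform H n).
Proof.
rewrite /transform; apply: (integrable2_sum (F := fun k w => H k w * x k w)) => k _.
by have [] := adapted_mul_step (@adaptedH k) (integrable2H k).
Qed.

Lemma mean_transform n : mean_real P (transform H n) = 0.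
Proof.
rewrite /transform (mean_real_sum (F := fun k w => H k w * x k w)); last first.
  move=> i _; apply: integrable2_1.
  by have [] := adapted_mul_step (@adaptedH i) (integrable2H i).
rewrite big1// => i _.
by have [] := mean_adapted_step (@adaptedH i) (integrable2_1 (integrable2H i)).
Qed.

(** Martingale increments are orthogonal: in the expansion of the square, the cross term is an
    integrable adapted factor times a centered step, hence has mean zero. *)
Lemma mean_transform_sqr n : mean_real P (fun w => transform H n w ^+ 2) =
  (\sum_(k < n) mean_real P (fun w => H k w ^+ 2)) * step_variance.
Proof.
elim: n => [|n IH].
  rewrite big_ord0 mul0r -[RHS](mean_real_cst P 0); congr mean_real.
  by apply/funext => w; rewrite /transform big_ord0 expr0n.
have [i2 e2] := adapted_mul_step (@adaptedH n) (integrable2H n).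
have iY := transform_integrable2 n.
have [i3 e3] : integrable1 P (fun w => transform H n w * H n w * x n w) /\
    mean_real P (fun w => transform H n w * H n w * x n w) = 0.
  apply: mean_adapted_step; last exact: integrable2M.
  by apply: measurable_funM; [exact: transform_adapted | exact: adaptedH].
rewrite big_ord_recr mulrDl -IH -e2.
have -> : (fun w => transform H n.+1 w ^+ 2) = (fun w =>
    (transform H n w ^+ 2 + (H n w * x n w) ^+ 2) +
    2 * (transform H n w * H n w * x n w)).
  by apply/funext => w; rewrite /transform big_ord_recr /=; ring.
rewrite mean_realD; last 2 first.
  by apply: integrable1D; [case: iY | case: i2].
  exact: integrable1Z.
by rewrite mean_realZ// e3 mulr0 addr0 mean_realD//; [case: iY | case: i2].
Qed.

End martingale_transform.

(** * Doob's inequality *)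

Section running_maximum.
Context {R : realDomainType}.
Implicit Types s a : nat -> R.

Fixpoint running_max s n :=
  if n is n'.+1 then Num.max (running_max s n') (s n) else s 0%N.

Lemma running_max_ge s n i : (i <= n)%N -> s i <= running_max s n.
Proof.
elim: n => [|n IH] /=; first by rewrite leqn0 => /eqP ->.
by rewrite leq_eqVlt ltnS le_max => /orP[/eqP ->|/IH ->//]; rewrite lexx orbT.
Qed.

Lemma running_max_le s n B :
  running_max s n <= B <-> forall i, (i <= n)%N -> s i <= B.
Proof.
split => [h i ni|]; first exact: le_trans (running_max_ge s ni) h.
elim: n => [|n IH] /= h; first exact: h.
by rewrite ge_max h// andbT; apply: IH => i /leqW; exact: h.
Qed.

End running_maximum.

Section pathwise_doob.
Context {R : realFieldType}.
Variable a : nat -> R.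
Let s n := \sum_(k < n) a k.

Let sS n : s n.+1 = s n + a n.
Proof. by rewrite /s big_ord_recr. Qed.

Lemma running_max_psum_ge0 n : 0 <= running_max s n.
Proof. by have := running_max_ge s (leq0n n); rewrite {1}/s big_ord0. Qed.

Lemma sqr_psum n :
  s n ^+ 2 = \sum_(k < n) a k ^+ 2 + 2 * \sum_(k < n) s k * a k.
Proof.
elim: n => [|n IH]; first by rewrite /s !big_ord0 expr0n mulr0 addr0.
by rewrite sS !big_ord_recr /= sqrrD IH; ring.
Qed.

(** Summation by parts. Both sides grow equally while the maximum stands still; when it jumps from
    [m] to [m'], the right-hand side gains [(m' - m)^2 / 2] more. *)
Lemma sum_running_max_le n : \sum_(k < n) running_max s k * a k <=
  running_max s n * s n - running_max s n ^+ 2 / 2.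
Proof.
elim: n => [|n IH].
  by rewrite /= /s !big_ord0 mulr0 expr0n mul0r subrr.
rewrite big_ord_recr /= sS; set m := running_max s n in IH *.
case: (leP m (s n + a n)) => h; last by lra.
nra.
Qed.

(** By [sqr_psum] the right-hand side is [4 s_n^2] minus four times the sum in [sum_running_max_le],
    hence at least [(m - 2 s_n)^2 + m^2] with [m] the maximum. *)
Lemma pathwise_doob n : running_max s n ^+ 2 <=
  4 * \sum_(k < n) a k ^+ 2 +
  4 * \sum_(k < n) (2 * s k - running_max s k) * a k.
Proof.
have -> : \sum_(k < n) (2 * s k - running_max s k) * a k =
    2 * \sum_(k < n) s k * a k - \sum_(k < n) running_max s k * a k.
  rewrite mulr_sumr -sumrB; apply: eq_bigr => k _; ring.
have := sum_running_max_le n; have := sqr_psum n.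
set X := \sum_(k < n) _ ^+ 2; set Y := \sum_(k < n) s _ * _.
set Z := \sum_(k < n) _ * _; set m := running_max s n; move=> e h.
have := sqr_ge0 (m - 2 * s n); nra.
Qed.

End pathwise_doob.

Section doob.
Context {d : measure_display} {T : measurableType d} {R : realType}.
Variables (P : probability T R) (x : nat -> T -> R).
Hypothesis xP : centered_iid P x.

Definition psum n w := \sum_(k < n) x k w.

Definition max_psum n w := running_max (psum ^~ w) n.

Let V := step_variance P x.
Let V0 : 0 <= V. Proof. exact: step_variance_ge0. Qed.

Lemma psum_transform : psum = transform x (fun _ _ => 1).
Proof.
apply/funext => n; apply/funext => w; rewrite /psum /transform.
by apply: eq_bigr => k _; rewrite mul1r.
Qed.

Lemma psum_adapted n : adapted x n (psum n).
Proof.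
rewrite psum_transform; apply: transform_adapted => k.
exact: measurable_cst.
Qed.

Lemma psum_integrable2 n : integrable2 P (psum n).
Proof.
by apply: (integrable2_sum (F := x)) => k _; exact: (integrable2_step xP).
Qed.

Lemma mean_psum_sqr n : mean_real P (fun w => psum n w ^+ 2) = n%:R * V.
Proof.
rewrite psum_transform mean_transform_sqr//; last 2 first.
- by move=> k; exact: measurable_cst.
- by move=> k; exact: integrable2_cst.
congr (_ * _); rewrite expr1n mean_real_cst.
by rewrite sumr_const card_ord.
Qed.

Lemma max_psum_adapted n : adapted x n (max_psum n).
Proof.
rewrite /adapted; elim: n => [|n IH]; first exact: psum_adapted.
apply: measurable_maxr; last exact: psum_adapted.
exact: (adapted_le (leqnSn n) IH).
Qed.

Lemma max_psum_integrable2 n : integrable2 P (max_psum n).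
Proof.
elim: n => [|n IH]; first exact: psum_integrable2.
by apply: integrable2_max => //; exact: psum_integrable2.
Qed.

Lemma max_psum_ge0 n w : 0 <= max_psum n w.
Proof. exact: (running_max_psum_ge0 (x ^~ w)). Qed.

Let H k w := 2 * psum k w - max_psum k w.

Let adaptedH k : adapted x k (H k).
Proof.
apply: measurable_funB; last exact: max_psum_adapted.
by apply: measurable_funM => //; exact: psum_adapted.
Qed.

Let integrable2H k : integrable2 P (H k).
Proof.
apply: integrable2B; last exact: max_psum_integrable2.
exact/integrable2Z/psum_integrable2.
Qed.

Let sumsq n w := \sum_(k < n) x k w ^+ 2.

Let integrable1_sumsq n : integrable1 P (sumsq n).
Proof.
apply: (integrable1_sum (F := fun k w => x k w ^+ 2)) => k _.
by case: (integrable2_step xP k).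
Qed.

Let mean_sumsq n : mean_real P (sumsq n) = n%:R * V.
Proof.
rewrite (mean_real_sum (F := fun k w => x k w ^+ 2)); last first.
  by move=> k _; case: (integrable2_step xP k).
under eq_bigr do rewrite mean_step_sqr//.
by rewrite sumr_const card_ord mulr_natl.
Qed.

Let doob_bound n w :
  max_psum n w ^+ 2 <= 4 * sumsq n w + 4 * transform x H n w.
Proof. exact: (pathwise_doob (x ^~ w)). Qed.

Lemma mean_max_psum_sqr n :
  mean_real P (fun w => max_psum n w ^+ 2) <= 4 * n%:R * V.
Proof.
have iY := integrable2_1 (transform_integrable2 xP adaptedH integrable2H n).
apply: le_trans (mean_real_le _ _ (doob_bound n)) _.
- by case: (max_psum_integrable2 n).
- by apply: integrable1D; exact: integrable1Z.
rewrite mean_realD; [|exact: integrable1Z..].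
rewrite !mean_realZ// mean_transform//.
by rewrite mulr0 addr0 mean_sumsq mulrA.
Qed.

Lemma doob_transform_integrable2 n : integrable2 P
  (transform x (fun k w => 2 * psum k w - max_psum k w) n).
Proof. exact: (transform_integrable2 xP adaptedH integrable2H). Qed.

Lemma mean_doob_transform_sqr n :
  mean_real P (fun w =>
    transform x (fun k v => 2 * psum k v - max_psum k v) n w ^+ 2) <=
  16 * n%:R ^+ 2 * V ^+ 2.
Proof.
rewrite mean_transform_sqr// -/V.
(* It suffices that each squared integrand has mean at most [16 n V]. It is at most
   [8 s_k^2 + 2 max^2], and both terms have mean at most [8 k V]. *)
rewrite (_ : 16 * _ * _ = (\sum_(k < n) 16 * n%:R * V) * V); last first.
  by rewrite sumr_const card_ord -mulr_natl; ring.
apply: ler_wpM2r => //; apply: ler_sum => k _.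
have [[_ i1] [_ i2]] := (psum_integrable2 k, max_psum_integrable2 k).
apply: (@le_trans _ _ (mean_real P
    (fun w => 8 * psum k w ^+ 2 + 2 * max_psum k w ^+ 2))).
  apply: mean_real_le.
  - by case: (integrable2H k).
  - by apply: integrable1D; exact: integrable1Z.
  by move=> w; rewrite /H; have := sqr_ge0 (2 * psum k w + max_psum k w); nra.
rewrite mean_realD; [|exact: integrable1Z..].
rewrite !mean_realZ// mean_psum_sqr.
have := mean_max_psum_sqr k.
have kn : k%:R <= n%:R :> R by rewrite ler_nat ltnW.
have : k%:R * V <= n%:R * V by rewrite ler_wpM2r.
rewrite -!mulrA; lra.
Qed.

End doob.

(** * Uniform integrability of the squared maxima, relative to the number of steps *)

Section uniform_integrability.
Context {d : measure_display} {T : measurableType d} {R : realType}.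
Variable P : probability T R.

Lemma integrable1_excess f K : integrable1 P f -> 0 <= K ->
  integrable1 P (fun w => Num.max (f w - K) 0).
Proof.
move=> i1 K0; have i1' : integrable1 P (fun w => `|f w|).
  exact: eq_integrable (integrable_abse i1).
have mf := integrable1_measurable i1.
apply: integrable1_le i1' _.
  by apply: measurable_maxr => //; apply: measurable_funB.
move=> w; rewrite ger0_norm ?le_max ?lexx ?orbT// ge_max normr_ge0 andbT.
by rewrite lerBlDr (le_trans (ler_norm _))// lerDl.
Qed.

(** Dominated convergence along integer thresholds: at each point the truncated excess is eventually
    0, and it never exceeds [f]. *)
Lemma mean_real_excess f e : integrable1 P f -> (forall w, 0 <= f w) -> 0 < e ->
  exists2 K, 0 <= K & mean_real P (fun w => Num.max (f w - K) 0) <= e.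
Proof.
move=> i1 f0 e0; have mf := integrable1_measurable i1.
pose g (n : nat) w := Num.max (f w - n%:R) 0.
have g0 n w : 0 <= g n w by rewrite /g le_max lexx orbT.
have := @dominated_convergence _ _ _ P setT measurableT
  (fun n w => (g n w)%:E) (cst 0%E) (EFin \o f).
case.
- move=> n; apply/measurable_EFinP; apply: measurable_maxr => //.
  exact: measurable_funB.
- exact: measurable_cst.
- apply: aeW => w _; apply/fine_cvgP; split; first exact: nearW.
  apply: cvg_near_cst; near=> n; rewrite /= /g; apply/max_idPr.
  rewrite subr_le0; near: n.
  by exists (Num.truncn (f w)).+1 => // n /= h; apply/ltW;
    rewrite (lt_le_trans (truncnS_gt _))// ler_nat.
- exact: i1.
- apply: aeW => w n _; rewrite /= lee_fin ger0_norm// ge_max f0 andbT.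
  by rewrite lerBlDr lerDl.
rewrite integral0 => _ _ /fine_cvgP[_].
move=> /cvgrPdist_lt /(_ e e0)[N _ /(_ N (leqnn N))].
rewrite sub0r normrN /= => h; exists N%:R => //.
by rewrite (le_trans (ler_norm _))// ltW.
Unshelve. all: end_near. Qed.

Variable x : nat -> T -> R.
Hypothesis xP : centered_iid P x.

(** In the pathwise Doob bound, each [x_k^2] is at most [K] plus its excess over [K], whose mean is
    small. The martingale [Y] is split into a constant of order [n], which matters only on [A], and
    a multiple of [Y^2 / n], controlled by its variance. The constants are integrated over [A] and
    are small when [P A] is. *)
Lemma max_psum_uniform_integrable e : 0 < e ->
  exists2 p, 0 < p & forall n A, measurable A -> fine (P A) <= p ->
    mean_real P (fun w => max_psum x n w ^+ 2 * \1_A w) <= e * n%:R.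
Proof.
move=> e0; set V := step_variance P x.
have V0 : 0 <= V by exact: step_variance_ge0.
have [K K0 hK] := mean_real_excess (centered_iid_integrable2 xP).2
  (fun w => sqr_ge0 _) (divr_gt0 e0 (ltr0n R 16)).
(* The three contributions are each at most [e / 4] per step: four excesses of mean [e / 16], the
   constants [(4 K + 2 c) * p], and [32 V^2 / c] from [Y^2]. The summand 1 keeps [c] positive when
   [V] is 0. *)
pose c := 128 * V ^+ 2 / e + 1.
have c0 : 0 < c.
  by rewrite ltr_wpDl// divr_ge0 ?(ltW e0)// mulr_ge0 ?sqr_ge0.
pose p := e / (16 * K + 8 * c).
have D0 : 0 < 16 * K + 8 * c by lra.
exists p; first by rewrite divr_gt0.
move=> [|n] A mA PA.
  rewrite mulr0 (_ : (fun w => _) = fun=> 0) ?mean_real_cst//.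
  by apply/funext => w; rewrite /max_psum /= /psum big_ord0 expr0n mul0r.
set N := n.+1; have N0 : 0 < N%:R :> R by rewrite ltr0n.
pose H k w := 2 * psum x k w - max_psum x k w.
pose Y := transform x H N.
pose ex k w := Num.max (x k w ^+ 2 - K) 0.
have ix2 k : integrable1 P (fun w => x k w ^+ 2) by case: (integrable2_step xP k).
have iex k : integrable1 P (ex k) by exact: integrable1_excess.
have mean_ex k : mean_real P (ex k) <= e / 16.
  pose phi (y : R) := Num.max (y ^+ 2 - K) 0.
  have mphi : measurable_fun setT phi.
    by apply: measurable_maxr => //; apply: measurable_funB.
  by have [_ ->] := @centered_iid_transfer _ _ _ _ _ xP phi k mphi (iex 0%N).
have iY : integrable2 P Y := doob_transform_integrable2 xP N.
have i1A : integrable1 P (\1_A : T -> R).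
  have := integrable1_indic mA (integrable1_cst P 1).
  by apply: eq_integrable => // w _; rewrite /= mul1r.
have bound w : max_psum x N w ^+ 2 * \1_A w <=
    (4 * \sum_(k < N) ex k w + (4 * N%:R * K + 2 * (N%:R * c)) * \1_A w) +
    2 / (N%:R * c) * Y w ^+ 2.
  have h := pathwise_doob (x ^~ w) N.
  have le_ex : \sum_(k < N) x k w ^+ 2 <= \sum_(k < N) ex k w + N%:R * K.
    rewrite mulr_natl -[X in _ *+ X](card_ord N) -sumr_const -big_split /=.
    by apply: ler_sum => k _; rewrite /ex -lerBlDr le_max lexx.
  have ex0 : 0 <= \sum_(k < N) ex k w.
    by apply: sumr_ge0 => k _; rewrite /ex le_max lexx orbT.
  have L0 : 0 < N%:R * c by rewrite mulr_gt0.
  (* AM-GM: [2 Y <= L + Y^2 / L] with [L = N c] *)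
  have amgm : 4 * Y w <= 2 * (N%:R * c) + 2 / (N%:R * c) * Y w ^+ 2.
    rewrite -subr_ge0.
    have -> : 2 * (N%:R * c) + 2 / (N%:R * c) * Y w ^+ 2 - 4 * Y w =
        2 / (N%:R * c) * (Y w - N%:R * c) ^+ 2.
      by field; rewrite !gt_eqF.
    by rewrite mulr_ge0 ?sqr_ge0// divr_ge0 ?ltW.
  have Y20 : 0 <= 2 / (N%:R * c) * Y w ^+ 2.
    by rewrite mulr_ge0 ?sqr_ge0// divr_ge0 ?ltW.
  rewrite indicE; case: (w \in A) => /=; rewrite ?mulr1 ?mulr0; last by lra.
  apply: le_trans h _.
  move: amgm; rewrite /Y /transform /H /psum /max_psum; lra.
have iS : integrable1 P (fun w => \sum_(k < N) ex k w) by exact: integrable1_sum.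
apply: le_trans (mean_real_le _ _ bound) _.
- by apply: integrable1_indic => //; case: (max_psum_integrable2 xP N).
- apply: integrable1D; last by apply: integrable1Z; case: iY.
  by apply: integrable1D; exact: integrable1Z.
rewrite mean_realD; last 2 first.
- by apply: integrable1D; exact: integrable1Z.
- by apply: integrable1Z; case: iY.
rewrite mean_realD; [|exact: integrable1Z..].
rewrite !mean_realZ//; last by case: iY.
rewrite mean_real_sum// mean_real_indic//.
have s1 : \sum_(k < N) mean_real P (ex k) <= N%:R * (e / 16).
  rewrite mulr_natl -[X in _ *+ X](card_ord N) -sumr_const.
  by apply: ler_sum => k _.
have s2 : (4 * N%:R * K + 2 * (N%:R * c)) * fine (P A) <= N%:R * (e / 4).
  have -> : N%:R * (e / 4) = (4 * N%:R * K + 2 * (N%:R * c)) * p.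
    by rewrite /p; field; rewrite gt_eqF.
  by apply: ler_wpM2l => //; rewrite addr_ge0// !mulr_ge0// ltW.
have s3 : 2 / (N%:R * c) * mean_real P (fun w => Y w ^+ 2) <= N%:R * (e / 4).
  apply: (@le_trans _ _ (2 / (N%:R * c) * (16 * N%:R ^+ 2 * V ^+ 2))).
    apply: ler_wpM2l; first by rewrite divr_ge0// mulr_ge0 ?ltW.
    exact: mean_doob_transform_sqr.
  have -> : 2 / (N%:R * c) * (16 * N%:R ^+ 2 * V ^+ 2) = N%:R * (32 * V ^+ 2 / c).
    by field; rewrite !gt_eqF.
  rewrite ler_wpM2l// ler_pdivrMr//.
  have -> : e / 4 * c = 32 * V ^+ 2 + e / 4 by rewrite /c; field; rewrite gt_eqF.
  lra.
have : 0 < e * N%:R by rewrite mulr_gt0.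
lra.
Qed.

End uniform_integrability.

(** * Plane geometry *)

Section euclidean_norm.
Context {R : realType}.
Implicit Types (x y : R * R) (a : R).

Lemma enorm_ge0 x : 0 <= enorm x.
Proof. exact: sqrtr_ge0. Qed.

Lemma enorm_sqr x : enorm x ^+ 2 = dot x x.
Proof. by rewrite sqr_sqrtr// /dot -!expr2 addr_ge0 ?sqr_ge0. Qed.

Lemma enormP x a : 0 <= a -> (enorm x <= a) = (dot x x <= a ^+ 2).
Proof. by move=> a0; rewrite -enorm_sqr ler_sqr ?nnegrE ?enorm_ge0. Qed.

Lemma dot_le_enorm x y : dot x y <= enorm x * enorm y.
Proof.
have [h|h] := lerP (dot x y) 0.
  by rewrite (le_trans h)// mulr_ge0 ?enorm_ge0.
rewrite -(ler_pXn2r (n := 2)) ?nnegrE ?mulr_ge0 ?enorm_ge0 ?(ltW h)//.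
rewrite exprMn !enorm_sqr /dot.
(* Lagrange's identity: this square is the difference of the two sides. *)
have := sqr_ge0 (x.1 * y.2 - x.2 * y.1); nra.
Qed.

Lemma enormD x y : enorm (x + y) <= enorm x + enorm y.
Proof.
rewrite enormP ?addr_ge0 ?enorm_ge0//.
have -> : dot (x + y) (x + y) = dot x x + dot y y + 2 * dot x y.
  by rewrite /dot /=; ring.
by rewrite sqrrD !enorm_sqr; have := dot_le_enorm x y; lra.
Qed.

Lemma enormZ a x : enorm (a *: x) = `|a| * enorm x.
Proof.
rewrite /enorm -sqrtr_sqr -sqrtrM ?sqr_ge0//; congr Num.sqrt.
by rewrite /dot /= /GRing.scale /=; ring.
Qed.

Lemma enormN x : enorm (- x) = enorm x.
Proof. by rewrite -scaleN1r enormZ normrN1 mul1r. Qed.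

Lemma enorm_distC x y : enorm (x - y) = enorm (y - x).
Proof. by rewrite -enormN opprB. Qed.

Lemma enormB x y : enorm (x - y) <= enorm x + enorm y.
Proof. by rewrite -(enormN y); exact: enormD. Qed.

Lemma enorm_le_normD x : enorm x <= `|x.1| + `|x.2|.
Proof.
rewrite enormP ?addr_ge0// /dot -!expr2 sqrrD !real_normK ?num_real//.
by rewrite -subr_ge0; have := mulr_ge0 (normr_ge0 x.1) (normr_ge0 x.2); lra.
Qed.

End euclidean_norm.

(** * Deterministic bounds on the distances between points of two walks *)

Section walks_diameter.
Context {R : realType}.
Variables (e mu1 mu2 : R * R) (m m' : R).
Let kappa := m - m'.
Hypothesis mu1E : mu1 = m *: e.
Hypothesis unit_e : dot e e = 1.
Hypothesis mu2_le : enorm mu2 <= m'.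
Hypothesis mu12_le : enorm (mu1 - mu2) <= m'.
Hypothesis m'_lt : m' < m.

Let m'0 : 0 <= m'. Proof. exact: le_trans (enorm_ge0 _) mu2_le. Qed.
Let m0 : 0 < m. Proof. exact: le_lt_trans m'0 m'_lt. Qed.
Let enorm_e : enorm e = 1. Proof. by rewrite /enorm unit_e sqrtr1. Qed.
Let enorm_mu1 : enorm mu1 = m.
Proof. by rewrite mu1E enormZ enorm_e mulr1 gtr0_norm. Qed.

(** For [j <= i] the vector consists of [i - j] copies of [mu1] and [j] of [mu1 - mu2]; otherwise of
    [i] copies of [mu1 - mu2] and [j - i] of [- mu2]. In both cases [j] copies have length at most
    [m'] and so save at least [kappa] each. *)
Lemma drift_le (i j : nat) :
  enorm (i%:R *: mu1 - j%:R *: mu2) <= (maxn i j)%:R * m - j%:R * kappa.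
Proof.
case: (leqP j i) => ij.
  have -> : i%:R *: mu1 - j%:R *: mu2 =
      (i - j)%:R *: mu1 + j%:R *: (mu1 - mu2).
    by rewrite natrB// scalerBl scalerBr addrA subrK.
  apply: le_trans (enormD _ _) _; rewrite !enormZ !normr_nat enorm_mu1.
  have := ler_wpM2l (ler0n R j) mu12_le.
  by rewrite natrB// /kappa; lra.
have -> : i%:R *: mu1 - j%:R *: mu2 =
    i%:R *: (mu1 - mu2) - (j - i)%:R *: mu2.
  by rewrite natrB 1?ltnW// scalerBl scalerBr opprB addrA subrK.
apply: le_trans (enormB _ _) _; rewrite !enormZ !normr_nat.
have := ler_wpM2l (ler0n R i) mu12_le.
have := ler_wpM2l (ler0n R (j - i)) mu2_le.
by rewrite natrB 1?ltnW// /kappa; lra.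
Qed.

Variables S T : nat -> R * R.
Let M i := S i - i%:R *: mu1.
Let N i := T i - i%:R *: mu2.
Variables (n r : nat) (L a b eps : R).
Hypothesis (n0 : (0 < n)%N) (rn : (r <= n)%N).
Hypothesis ML : forall i, (i <= n)%N -> enorm (M i) <= L.
Hypothesis NL : forall i, (i <= n)%N -> enorm (N i) <= L.
Hypothesis Ma : forall i, (i <= r)%N -> enorm (M i) <= a.
Hypothesis Na : forall i, (i <= r)%N -> enorm (N i) <= a.
Hypothesis Mb : forall i, (n - r <= i <= n)%N -> enorm (M n - M i) <= b.

(** The distances from [T i] to [S j] are covered by symmetry, as [i] and [j] range over the same
    indices. *)
Definition pairwise_le B := forall i j, (i <= n)%N -> (j <= n)%N ->
  [/\ enorm (S i - S j) <= B, enorm (S i - T j) <= B & enorm (T i - T j) <= B].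

Let L0 : 0 <= L. Proof. exact: le_trans (enorm_ge0 _) (ML (leq0n n)). Qed.

Let SE i : S i = M i + i%:R *: mu1. Proof. by rewrite /M subrK. Qed.
Let TE i : T i = N i + i%:R *: mu2. Proof. by rewrite /N subrK. Qed.

Let rearrange (u v u' v' : R * R) : (u + u') - (v + v') = (u' - v') + (u - v).
Proof. by rewrite opprD addrACA addrC. Qed.

Let noise (u v : R * R) : enorm u <= L -> enorm v <= L -> enorm (u - v) <= 2 * L.
Proof.
by move=> hu hv; rewrite (le_trans (enormB _ _))// mulr2n mulrDl mul1r lerD.
Qed.

Let SS_le i j : (i <= n)%N -> (j <= n)%N ->
  enorm (S i - S j) <= `|i%:R - j%:R| * m + 2 * L.
Proof.
move=> ni nj; rewrite !SE rearrange (le_trans (enormD _ _))//.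
by rewrite -scalerBl enormZ enorm_mu1 lerD2l noise// ML.
Qed.

Let ST_le i j : (i <= n)%N -> (j <= n)%N ->
  enorm (S i - T j) <= (maxn i j)%:R * m - j%:R * kappa + 2 * L.
Proof.
move=> ni nj; rewrite SE TE rearrange (le_trans (enormD _ _))//.
by rewrite lerD ?drift_le ?noise ?ML ?NL.
Qed.

Let TT_le i j : (i <= n)%N -> (j <= n)%N ->
  enorm (T i - T j) <= n%:R * m' + 2 * L.
Proof.
move=> ni nj; rewrite !TE rearrange (le_trans (enormD _ _))//.
rewrite -scalerBl enormZ lerD ?noise ?NL// ler_pM ?enorm_ge0//.
rewrite ler_norml; apply/andP; split.
  by rewrite lerBrDr addrC -lerBrDr opprK -natrD ler_nat (leq_trans nj)// leq_addl.
by rewrite lerBlDr -natrD ler_nat (leq_trans ni)// leq_addr.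
Qed.

Lemma pairwise_le_crude : pairwise_le (n%:R * m + 2 * L).
Proof.
have kappa0 : 0 <= kappa by rewrite subr_ge0 ltW.
move=> i j ni nj; split.
- apply: le_trans (SS_le ni nj) _; rewrite lerD2r ler_wpM2r ?(ltW m0)//.
  have : i%:R <= n%:R :> R by rewrite ler_nat.
  have : j%:R <= n%:R :> R by rewrite ler_nat.
  by rewrite ler_norml; have := ler0n R i; have := ler0n R j; lra.
- apply: le_trans (ST_le ni nj) _; rewrite lerD2r.
  have : (maxn i j)%:R * m <= n%:R * m.
    by rewrite ler_wpM2r ?(ltW m0)// ler_nat geq_max ni.
  by have := mulr_ge0 (ler0n R j) kappa0; lra.
- apply: le_trans (TT_le ni nj) _; rewrite lerD2r ler_wpM2l//; exact: ltW.
Qed.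

Let proj_ge : n%:R * m - L <= dot (S n) e.
Proof.
have -> : dot (S n) e = n%:R * m * dot e e + dot (M n) e.
  by rewrite SE mu1E /dot /= /GRing.scale /=; ring.
have := dot_le_enorm (- M n) e; rewrite enormN enorm_e mulr1.
have -> : dot (- M n) e = - dot (M n) e by rewrite /dot /=; ring.
rewrite unit_e; have := ML (leqnn n); lra.
Qed.

(** Two [L] come from the noise at the two points, the third from replacing [n m] by the projection
    of [S n]. *)
Lemma pairwise_le_crude_proj : pairwise_le (dot (S n) e + 3 * L).
Proof.
move=> i j ni nj; have [h1 h2 h3] := pairwise_le_crude ni nj.
by have := proj_ge; split; lra.
Qed.

(** The first two conditions give [2 L <= n kappa], so that noise cannot outweigh the gap between
    [m] and [m']. The third makes a saving of [kappa / 2] on each of [r.+1] steps worth [3 L]: two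
    for the noise and one for the projection of [S n]. *)
Hypothesis eps_kappa : 2 * eps <= kappa.
Hypothesis L_eps : L <= eps * n%:R.
Hypothesis L_far : 6 * L <= kappa * r.+1%:R.

Let nR0 : 0 < n%:R :> R. Proof. by rewrite ltr0n. Qed.

Let L_kappa : 2 * L <= n%:R * kappa.
Proof.
have := ler_wpM2r (ltW nR0) eps_kappa; have := L_eps; lra.
Qed.

(** The component of [S n] orthogonal to [e] is pure noise, at most [L], while the component along
    [e] is at least [n m / 2]. The norm thus exceeds the projection by at most [L^2 / (n m)], and
    [L <= eps n]. *)
Let endpoint_le : enorm (S n) <= dot (S n) e + eps / m * L.
Proof.
have eps0 : 0 <= eps.
  by have := le_trans L0 L_eps; rewrite pmulr_lge0.
have u0 : n%:R * m / 2 <= dot (S n) e.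
  have := proj_ge; have := L_kappa; rewrite /kappa.
  by have := mulr_ge0 (ltW nR0) m'0; lra.
have t0 : 0 <= eps / m * L by rewrite !mulr_ge0// invr_ge0 ltW.
have nm0 : 0 < n%:R * m by rewrite mulr_gt0.
rewrite enormP; last by rewrite addr_ge0// (le_trans _ u0)// divr_ge0// ltW.
(* Pythagoras in the basis [e], [e] rotated by a right angle. *)
pose v := (S n).1 * e.2 - (S n).2 * e.1.
have -> : dot (S n) (S n) = dot (S n) e ^+ 2 + v ^+ 2.
  by rewrite -[LHS]mulr1 -[X in _ * X]unit_e /v /dot; ring.
have vM : v = (M n).1 * e.2 - (M n).2 * e.1.
  by rewrite /v SE mu1E /= /GRing.scale /=; ring.
have vL : v ^+ 2 <= L ^+ 2.
  apply: (@le_trans _ _ (dot (M n) (M n))); last by rewrite -enormP// ML.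
  rewrite -[leRHS]mulr1 -unit_e vM /dot.
  have := sqr_ge0 ((M n).1 * e.1 + (M n).2 * e.2); nra.
have h1 : L ^+ 2 <= 2 * (n%:R * m / 2) * (eps / m * L).
  have -> : 2 * (n%:R * m / 2) * (eps / m * L) = eps * n%:R * L.
    by field; rewrite gt_eqF.
  by rewrite expr2 ler_wpM2r.
have h2 : 2 * (n%:R * m / 2) * (eps / m * L) <= 2 * dot (S n) e * (eps / m * L).
  by rewrite ler_wpM2r// ler_wpM2l.
have := le_trans vL (le_trans h1 h2); have := sqr_ge0 (eps / m * L).
move: (eps / m * L) (dot (S n) e) (v ^+ 2) => X D W X0 hW.
by rewrite sqrrD; lra.
Qed.

Let corner_le (z : R * R) : enorm z <= n%:R * m' -> enorm (M n + z) <= enorm (S n).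
Proof.
move=> hz; apply: le_trans (enormD _ _) _.
have h : n%:R * m <= enorm (S n) + enorm (M n).
  have -> : n%:R * m = enorm (S n - M n).
    by rewrite SE addrC addKr enormZ normr_nat enorm_mu1.
  exact: enormB.
have := ML (leqnn n); have := L_kappa; rewrite /kappa; lra.
Qed.

(* The left-hand side is convex in [(i, j)], hence maximal at a corner of the
   triangles cut out of [[0, n]^2] by the diagonal, where it is at most
   [|S n|]. *)
Lemma drift_endpoint_le i j : (i <= n)%N -> (j <= n)%N ->
  enorm (M n + (i%:R *: mu1 - j%:R *: mu2)) <= enorm (S n).
Proof.
(* Multiplying by [n] turns the barycentric weights of [(i, j)] into natural numbers. The corners
   are [(0, 0)], [(n, n)] and either [(n, 0)], which yields [S n], or [(0, n)]. *)
move=> ni nj; rewrite -(ler_pM2l nR0) -{1}(normr_nat R n) -enormZ.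
have nm'0 : 0 <= n%:R * m' by rewrite mulr_ge0.
have c1 : enorm (M n) <= enorm (S n).
  by rewrite -[M n]addr0 corner_le// -(scale0r e) enormZ normr0 mul0r.
have c2 : enorm (M n + n%:R *: (mu1 - mu2)) <= enorm (S n).
  by rewrite corner_le// enormZ normr_nat ler_wpM2l.
have c3 : enorm (M n - n%:R *: mu2) <= enorm (S n).
  by rewrite corner_le// enormN enormZ normr_nat ler_wpM2l.
have wZ k (z : R * R) : enorm z <= enorm (S n) ->
    enorm (k%:R *: z) <= k%:R * enorm (S n).
  by move=> hz; rewrite enormZ normr_nat ler_wpM2l.
case: (leqP j i) => ij.
  have -> : n%:R *: (M n + (i%:R *: mu1 - j%:R *: mu2)) =
      (n - i)%:R *: M n + ((i - j)%:R *: S n +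
      j%:R *: (M n + n%:R *: (mu1 - mu2))).
    rewrite !natrB// SE; move: (M n) mu1 mu2 => [x1 x2] [y1 y2] [z1 z2].
    by congr pair; rewrite /= /GRing.scale /=; ring.
  apply: le_trans (enormD _ _) _.
  have h1 := wZ (n - i)%N _ c1; have h2 := wZ (i - j)%N _ (lexx _).
  have h3 := wZ j _ c2; have h4 := enormD ((i - j)%:R *: S n)
    (j%:R *: (M n + n%:R *: (mu1 - mu2))).
  move: h1 h2 h4; rewrite !natrB//; lra.
have ij' := ltnW ij.
have -> : n%:R *: (M n + (i%:R *: mu1 - j%:R *: mu2)) =
    (n - j)%:R *: M n + (i%:R *: (M n + n%:R *: (mu1 - mu2)) +
    (j - i)%:R *: (M n - n%:R *: mu2)).
  rewrite !natrB//; move: (M n) mu1 mu2 => [x1 x2] [y1 y2] [z1 z2].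
  by congr pair; rewrite /= /GRing.scale /=; ring.
apply: le_trans (enormD _ _) _.
have h1 := wZ (n - j)%N _ c1; have h2 := wZ i _ c2.
have h3 := wZ (j - i)%N _ c3; have h4 := enormD
  (i%:R *: (M n + n%:R *: (mu1 - mu2))) ((j - i)%:R *: (M n - n%:R *: mu2)).
move: h1 h3 h4; rewrite !natrB//; lra.
Qed.

(** A difference of walk points is [M n] plus a drift, minus the noise of the last steps up to [n]
    and of the first steps. When both index gaps fit within [r], these noises are at most [b] and
    [a] and [drift_endpoint_le] bounds the rest; otherwise the drift loses enough length. *)
Lemma pairwise_le_fine : pairwise_le (dot (S n) e + a + b + eps / m * L).
Proof.
have kappa0 : 0 <= kappa by rewrite subr_ge0 ltW.
have far B : B <= n%:R * m - kappa / 2 * r.+1%:R + 2 * L ->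
    B <= dot (S n) e + a + b + eps / m * L.
  have a0 : 0 <= a by exact: le_trans (enorm_ge0 _) (Ma (leq0n r)).
  have b0 : 0 <= b.
    by apply: le_trans (enorm_ge0 _) (Mb (i := n) _); rewrite leq_subr leqnn.
  have eps0 : 0 <= eps.
    by have := le_trans L0 L_eps; rewrite pmulr_lge0.
  have : 0 <= eps / m * L by rewrite !mulr_ge0// invr_ge0 ltW.
  have := proj_ge; have := L_far; lra.
have near i j (u v : R * R) : (i <= n)%N -> (j <= n)%N ->
    enorm u <= b -> enorm v <= a ->
    enorm (M n + (i%:R *: mu1 - j%:R *: mu2) - (u + v)) <=
    dot (S n) e + a + b + eps / m * L.
  move=> ni nj hu hv; apply: le_trans (enormB _ _) _.
  have := enormD u v; have := drift_endpoint_le ni nj; have := endpoint_le; lra.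
have SS i j : (i <= j)%N -> (j <= n)%N ->
    enorm (S j - S i) <= dot (S n) e + a + b + eps / m * L.
  move=> ij nj; have ni := leq_trans ij nj.
  case: (leqP (n - j + i) r) => h.
    (* The null multiple of [mu2] brings the pair into the form required by [near]. *)
    have -> : S j - S i = M n + ((j - i)%:R *: mu1 - 0%:R *: mu2) -
        ((M n - M j) + M i).
      rewrite !SE natrB//; move: (M n) (M i) (M j) mu1 mu2.
      move=> [x1 x2] [y1 y2] [z1 z2] [u1 u2] [v1 v2].
      by congr pair; rewrite /= /GRing.scale /=; ring.
    apply: near => //; first by rewrite (leq_trans (leq_subr _ _)).
      by apply: Mb; rewrite nj andbT; clear -h rn ij nj; lia.
    by apply: Ma; clear -h; lia.
  apply: far; apply: le_trans (SS_le nj ni) _.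
  rewrite lerD2r -natrB// normr_nat.
  have : (j - i)%:R + r.+1%:R <= n%:R :> R
    by rewrite -natrD ler_nat; clear -h ij nj; lia.
  move/(ler_wpM2r (ltW m0)).
  have : kappa / 2 * r.+1%:R <= r.+1%:R * m.
    by rewrite mulrC ler_wpM2l// /kappa; have := m'0; have := m0; lra.
  lra.
move=> i j ni nj; split.
- case: (leqP i j) => ij; first by rewrite enorm_distC SS.
  by rewrite SS// ltnW.
- case: (leqP (n - i + j) r) => h.
    have -> : S i - T j = M n + (i%:R *: mu1 - j%:R *: mu2) -
        ((M n - M i) + N j).
      rewrite SE TE; move: (M n) (M i) (N j) mu1 mu2.
      move=> [x1 x2] [y1 y2] [z1 z2] [u1 u2] [v1 v2].
      by congr pair; rewrite /= /GRing.scale /=; ring.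
    apply: near => //; first by apply: Mb; rewrite ni andbT; clear -h rn ni; lia.
    by apply: Na; clear -h; lia.
  apply: far; apply: le_trans (ST_le ni nj) _; rewrite lerD2r.
  (* The deficit [n - max i j + j] is at least half of [n - i + j]. *)
  have : r.+1%:R <= 2 * (n%:R - (maxn i j)%:R + j%:R) :> R.
    have mn : (maxn i j <= n)%N by rewrite geq_max ni.
    rewrite -natrB// -natrD -natrM ler_nat; clear -h mn ni nj; lia.
  have mn : 0 <= n%:R - (maxn i j)%:R :> R.
    by rewrite subr_ge0 ler_nat geq_max ni.
  move/(ler_wpM2l kappa0).
  have := mulr_ge0 mn m'0; rewrite /kappa; lra.
(* Two points of the second walk are always far: their drift saves [n kappa], and [r.+1 <= 2 n]. *)
- apply: far; apply: le_trans (TT_le ni nj) _; rewrite lerD2r.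
  have : r.+1%:R <= 2 * n%:R :> R by rewrite -natrM ler_nat; clear -rn n0; lia.
  by move/(ler_wpM2l kappa0); rewrite /kappa; lra.
Qed.

End walks_diameter.

(** * Diameter of the hull *)

Section hull_diameter.
Context {R : realType}.
Implicit Types (A : set (R * R)) (p q : R * R) (B : R).

Lemma sub_convex_hull A : A `<=` convex_hull A.
Proof. exact: sub_smallest. Qed.

Lemma convex_set_enorm_ball q B :
  @convex_set R (R * R)%type [set p | enorm (p - q) <= B].
Proof.
move=> x y l /[!inE] /= hx hy.
pose t : R := l%:num; have t0 : 0 <= t by rewrite /t.
have t1 : 0 <= 1 - t by rewrite subr_ge0 /t.
have -> : conv l x y - q = t *: (x - q) + (1 - t) *: (y - q).
  rewrite /conv /= /unstable.onem -/t.
  case: q x y hx hy => [q1 q2] [x1 x2] [y1 y2] _ _.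
  by congr pair; rewrite /= /GRing.scale /=; ring.
apply: le_trans (enormD _ _) _; rewrite !enormZ !ger0_norm//.
by have := ler_wpM2l t0 hx; have := ler_wpM2l t1 hy; lra.
Qed.

(** Balls are convex, so a ball containing [A] contains its hull. This is applied twice: first with
    the center in [A], then with the center in the hull. *)
Lemma convex_hull_dist_le A B : (forall p q, A p -> A q -> enorm (p - q) <= B) ->
  forall p q, convex_hull A p -> convex_hull A q -> enorm (p - q) <= B.
Proof.
move=> AB; have hullA q : A q -> forall p, convex_hull A p -> enorm (p - q) <= B.
  move=> Aq p /(_ [set p | enorm (p - q) <= B]); apply; split => [|r Ar].
    exact: convex_set_enorm_ball.
  exact: AB.
move=> p q hp /(_ [set q | enorm (q - p) <= B]); rewrite enorm_distC; apply.
split => [|r Ar]; first exact: convex_set_enorm_ball.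
by rewrite /= enorm_distC; exact: hullA.
Qed.

Lemma diameter_hull_le A B : A !=set0 ->
  (forall p q, A p -> A q -> enorm (p - q) <= B) ->
  diameter (convex_hull A) <= B.
Proof.
move=> [p Ap] AB; apply: ge_sup.
  by exists (enorm (p - p)), (p, p) => //; split; exact: sub_convex_hull.
by move=> _ [[u v] /= [hu hv] <-]; exact: convex_hull_dist_le hu hv.
Qed.

(** The bound [B] ensures that the distances are bounded above, so that [sup] is a genuine supremum
    and not its default value. *)
Lemma diameter_hull_ge A B p q :
  (forall p q, A p -> A q -> enorm (p - q) <= B) ->
  A p -> A q -> enorm (p - q) <= diameter (convex_hull A).
Proof.
move=> AB Ap Aq; apply: ub_le_sup.
  by exists B => _ [[u v] /= [hu hv] <-]; exact: convex_hull_dist_le hu hv.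
by exists (p, q) => //; split; exact: sub_convex_hull.
Qed.

End hull_diameter.

(** * The diameter as a finite maximum of distances, and its measurability *)

Section diameter_walks.
Context {d : measure_display} {T : measurableType d} {R : realType}.
Variables (P : probability T R) (Z1 Z2 : nat -> {RV P >-> (R * R)%type}).

Let dist (w : T) i j :=
  Num.max (enorm (walk Z1 i w - walk Z1 j w))
    (Num.max (enorm (walk Z1 i w - walk Z2 j w))
             (enorm (walk Z2 i w - walk Z2 j w))).

(** An explicit form of the diameter: it supplies the a priori bound needed for the supremum, and it
    is measurable as a finite maximum. *)
Let max_dist n w := running_max (fun i => running_max (dist w i) n) n.

Let max_distP n w B :
  pairwise_le (walk Z1 ^~ w) (walk Z2 ^~ w) n B <-> max_dist n w <= B.
Proof.
rewrite /max_dist running_max_le; split.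
  move=> h i ni; apply/running_max_le => j nj; have [? ? ?] := h i j ni nj.
  by rewrite /dist !ge_max; apply/and3P.
move=> h i j ni nj; have /running_max_le /(_ j nj) := h i ni.
by rewrite /dist !ge_max => /and3P.
Qed.

(** The hull has the diameter of its generating points; this equivalence carries the deterministic
    bounds on walk points over to the diameter. *)
Lemma hull_diameter_le n w B :
  hull_diameter Z1 Z2 n w <= B <->
  pairwise_le (walk Z1 ^~ w) (walk Z2 ^~ w) n B.
Proof.
have pts C : pairwise_le (walk Z1 ^~ w) (walk Z2 ^~ w) n C -> forall p q,
    (walk_points Z1 n w `|` walk_points Z2 n w) p ->
    (walk_points Z1 n w `|` walk_points Z2 n w) q -> enorm (p - q) <= C.
  move=> h p q [] [i /= ni <-] [] [j /= nj <-].
  - by have [] := h i j ni nj.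
  - by have [] := h i j ni nj.
  - by rewrite enorm_distC; have [] := h j i nj ni.
  - by have [] := h i j ni nj.
have pt1 i : (i <= n)%N ->
    (walk_points Z1 n w `|` walk_points Z2 n w) (walk Z1 i w).
  by move=> ni; left; exists i.
have pt2 i : (i <= n)%N ->
    (walk_points Z1 n w `|` walk_points Z2 n w) (walk Z2 i w).
  by move=> ni; right; exists i.
split; last first.
  move=> h; apply: diameter_hull_le; last exact: pts.
  by exists (walk Z1 0 w); exact: pt1.
have hM : pairwise_le (walk Z1 ^~ w) (walk Z2 ^~ w) n (max_dist n w).
  by apply/max_distP.
move=> hB i j ni nj; have ge p q := diameter_hull_ge (p := p) (q := q) (pts _ hM).
by split; apply: le_trans hB; apply: ge; auto.
Qed.

Lemma measurable_enorm (f : T -> R * R) : measurable_fun setT f ->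
  measurable_fun setT (fun w => enorm (f w)).
Proof.
move=> mf; have m1 : measurable_fun setT (fun w => (f w).1).
  exact: measurableT_comp mf.
have m2 : measurable_fun setT (fun w => (f w).2) by exact: measurableT_comp mf.
rewrite /enorm /dot; apply: measurableT_comp.
  exact: (@continuous_measurable_fun R _ (@sqrt_continuous R)).
by apply: measurable_funD; apply: measurable_funM.
Qed.

Lemma measurable_walk (Z : nat -> {RV P >-> (R * R)%type}) n :
  measurable_fun setT (walk Z n).
Proof.
apply/measurable_fun_pairP; split.
  have -> : fst \o walk Z n = (fun w => \sum_(i < n) (Z i w).1).
    by apply/funext => w; rewrite /walk /= raddf_sum.
  by apply: measurable_sum => i; apply: measurableT_comp.
have -> : snd \o walk Z n = (fun w => \sum_(i < n) (Z i w).2).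
  by apply/funext => w; rewrite /walk /= raddf_sum.
by apply: measurable_sum => i; apply: measurableT_comp.
Qed.

Lemma measurable_pairB (f g : T -> R * R) : measurable_fun setT f ->
  measurable_fun setT g -> measurable_fun setT (fun w => f w - g w).
Proof.
move=> mf mg; apply/measurable_fun_pairP; split.
  by apply: (measurable_funB (f := fst \o f) (g := fst \o g));
    exact: measurableT_comp.
by apply: (measurable_funB (f := snd \o f) (g := snd \o g));
  exact: measurableT_comp.
Qed.

Lemma measurable_hull_diameter n :
  measurable_fun setT (hull_diameter Z1 Z2 n).
Proof.
have -> : hull_diameter Z1 Z2 n = max_dist n.
  apply/funext => w; apply/le_anti/andP; split.
    exact: (hull_diameter_le _ _ _).2 ((max_distP _ _ _).2 (lexx _)).
  exact: (max_distP _ _ _).1 ((hull_diameter_le _ _ _).1 (lexx _)).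
have mmax (f : nat -> T -> R) k : (forall i, measurable_fun setT (f i)) ->
    measurable_fun setT (fun w => running_max (f ^~ w) k).
  by move=> mf; elim: k => [|k IH] //=; exact: measurable_maxr.
apply: (mmax (fun i w => running_max (dist w i) n)) => i.
apply: (mmax (fun j w => dist w i j)) => j.
by do 2?[apply: measurable_maxr]; apply: measurable_enorm;
  apply: measurable_pairB; exact: measurable_walk.
Qed.

End diameter_walks.

(** * Fluctuations of the walks *)

Section centered_iid_constructions.
Context {d : measure_display} {T : measurableType d} {R : realType}.
Variable P : probability T R.

Lemma iid_centered_iid (Z : nat -> {RV P >-> (R * R)%type}) (g : R * R -> R) :
  iid Z -> measurable_fun setT g -> integrable2 P (g \o Z 0%N) ->
  mean_real P (g \o Z 0%N) = 0 -> centered_iid P (fun i => g \o Z i).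
Proof.
move=> [indepZ lawZ] mg i2 e0.
have mgB (B : set R) : measurable B -> measurable (g @^-1` B).
  by move=> mB; rewrite -[X in measurable X]setTI; exact: mg.
split => //.
- by move=> i; exact: measurableT_comp.
- move=> n B mB.
  have := indepZ [fset i in iota 0 n]%fset (fun i => g @^-1` B i)
    (fun i => mgB _ (mB i)).
  rewrite (perm_big (iota 0 n)) /=; last first.
    apply: uniq_perm; rewrite ?fset_uniq ?iota_uniq// => i.
    by rewrite !inE.
  rewrite -[n in iota 0 n]subn0 big_mkord => <-; congr (P _).
  apply/seteqP; split => w h i /= hi; apply: h => /=.
    by move: hi; rewrite !inE /= mem_iota add0n subn0.
  by rewrite !inE /= mem_iota add0n subn0.
- by move=> i B mB; exact: (lawZ i 0%N _ (mgB _ mB)).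
Qed.

Lemma centered_iid_shift (x : nat -> T -> R) k :
  centered_iid P x -> centered_iid P (fun i => x (k + i)%N).
Proof.
move=> xP; split.
- by move=> i; exact: (centered_iid_measurable xP).
- move=> n B mB.
  (* The first [k] steps are left unconstrained and contribute factors 1. *)
  pose B' i := if (i < k)%N then setT else B (i - k)%N.
  have mB' i : measurable (B' i) by rewrite /B'; case: ifP.
  have := centered_iid_independent xP (k + n) mB'.
  rewrite big_split_ord /= big1 ?mul1r; last first.
    by move=> i _; rewrite /B' ltn_ord preimage_setT probability_setT.
  have -> : \bigcap_(i in `I_(k + n)) x i @^-1` B' i =
      \bigcap_(i in `I_n) x (k + i)%N @^-1` B i.
    apply/seteqP; split => w h i /= ni.
      have := h (k + i)%N; rewrite /= ltn_add2l => /(_ ni).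
      by rewrite /B' ltnNge leq_addr addKn.
    rewrite /B'; case: ltnP => // ki.
    by have := h (i - k)%N; rewrite /= subnKC//; apply; rewrite ltn_subLR.
  move=> ->; congr (_ %:E); apply: eq_bigr => i _.
  by rewrite /B' ltnNge leq_addr addKn.
- move=> i B mB; rewrite (centered_iid_law xP)// addn0.
  by rewrite [RHS](centered_iid_law xP).
- by rewrite addn0; exact: integrable2_step.
- by rewrite addn0; exact: mean_step.
Qed.

Lemma step_variance_shift (x : nat -> T -> R) k : centered_iid P x ->
  step_variance P (fun i => x (k + i)%N) = step_variance P x.
Proof. by move=> xP; exact: (mean_step_sqr xP (k + 0)). Qed.

(* [W k n] stands for the largest fluctuation over the [n] steps following
   time [k]. *)
Record controlled (W : nat -> nat -> T -> R) := Controlled {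
  controlled_ge0 : forall k n w, 0 <= W k n w;
  controlled_integrable2 : forall k n, integrable2 P (W k n);
  controlled_sqr : exists2 C, 0 <= C &
    forall k n, mean_real P (fun w => W k n w ^+ 2) <= C * n%:R;
  controlled_uniform : forall e, 0 < e -> exists2 p, 0 < p &
    forall n A, measurable A -> fine (P A) <= p ->
    mean_real P (fun w => W 0%N n w ^+ 2 * \1_A w) <= e * n%:R }.

Lemma controlledD W1 W2 : controlled W1 -> controlled W2 ->
  controlled (fun k n w => W1 k n w + W2 k n w).
Proof.
move=> [p1 i1 [C1 C10 c1] u1] [p2 i2 [C2 C20 c2] u2].
have sq (a b : R) : (a + b) ^+ 2 <= 2 * a ^+ 2 + 2 * b ^+ 2.
  by have := sqr_ge0 (a - b); nra.
split.
- by move=> k n w; rewrite addr_ge0.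
- by move=> k n; exact: integrable2D.
- exists (2 * C1 + 2 * C2); first by rewrite addr_ge0// mulr_ge0.
  move=> k n; have [[_ s1] [_ s2]] := (i1 k n, i2 k n).
  apply: (@le_trans _ _ (mean_real P
      (fun w => 2 * W1 k n w ^+ 2 + 2 * W2 k n w ^+ 2))).
    apply: mean_real_le => //; first by case: (integrable2D (i1 k n) (i2 k n)).
    by apply: integrable1D; exact: integrable1Z.
  rewrite mean_realD; [|exact: integrable1Z..].
  by rewrite !mean_realZ//; have := c1 k n; have := c2 k n; lra.
(* With [(a + b)^2 <= 2 a^2 + 2 b^2], each summand may use [e / 4], half of the budget remaining
   unspent on neither side. *)
- move=> e e0; have e40 : 0 < e / 4 by rewrite divr_gt0.
  have [q1 q10 h1] := u1 _ e40; have [q2 q20 h2] := u2 _ e40.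
  exists (Num.min q1 q2); first by rewrite lt_min q10.
  move=> n A mA; rewrite le_min => /andP[/(h1 n _ mA) l1 /(h2 n _ mA) l2].
  have [[_ s1] [_ s2]] := (i1 0%N n, i2 0%N n).
  have [_ s3] := integrable2D (i1 0%N n) (i2 0%N n).
  have t1 := integrable1_indic mA s1; have t2 := integrable1_indic mA s2.
  apply: (@le_trans _ _ (mean_real P (fun w => 2 * (W1 0%N n w ^+ 2 * \1_A w) +
      2 * (W2 0%N n w ^+ 2 * \1_A w)))).
    apply: mean_real_le; first exact: integrable1_indic.
      by apply: integrable1D; exact: integrable1Z.
    by move=> w; rewrite indicE; case: (_ \in _); rewrite /= ?mulr1 ?mulr0 ?addr0.
  rewrite mean_realD; [|exact: integrable1Z..].
  by rewrite !mean_realZ//; lra.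
Qed.

Lemma controlled_max_psum x : centered_iid P x ->
  controlled (fun k => max_psum (fun i => x (k + i)%N)).
Proof.
move=> xP; have xkP k := centered_iid_shift k xP.
split.
- by move=> k n w; exact: max_psum_ge0.
- by move=> k n; exact: (max_psum_integrable2 (xkP k)).
- exists (4 * step_variance P x).
    by rewrite mulr_ge0// step_variance_ge0.
  move=> k n; rewrite -(step_variance_shift k xP).
  by rewrite mulrAC (mean_max_psum_sqr (xkP k)).
- by move=> e e0; exact: max_psum_uniform_integrable (xkP 0%N) e e0.
Qed.

End centered_iid_constructions.

Section fluctuations.
Context {d : measure_display} {T : measurableType d} {R : realType}.
Variables (P : probability T R) (Z : nat -> {RV P >-> (R * R)%type}).
Variable mu : R * R.

Let x1 i w := (Z i w).1 - mu.1.
Let x2 i w := (Z i w).2 - mu.2.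

(** Doob's inequality above controls one-sided maxima of scalar walks. Each maximum is nonnegative,
    so those of a walk and of its opposite add up to a bound on its absolute value; the two
    coordinates are then added. *)
Definition fluctuation k n w :=
  max_psum (fun i => x1 (k + i)%N) n w +
  max_psum (fun i => \- x1 (k + i)%N) n w +
  (max_psum (fun i => x2 (k + i)%N) n w +
   max_psum (fun i => \- x2 (k + i)%N) n w).

Lemma norm_psum_le (y : nat -> T -> R) n j w : (j <= n)%N ->
  `|psum y j w| <= max_psum y n w + max_psum (fun i => \- y i) n w.
Proof.
move=> jn; have yN : psum (fun i => \- y i) j w = - psum y j w.
  by rewrite /psum sumrN.
have h1 : psum y j w <= max_psum y n w := running_max_ge (psum y ^~ w) jn.
have h2 : psum (fun i => \- y i) j w <= max_psum (fun i => \- y i) n w :=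
  running_max_ge (psum (fun i => \- y i) ^~ w) jn.
have h3 := max_psum_ge0 y n w; have h4 := max_psum_ge0 (fun i => \- y i) n w.
by rewrite ler_norml; lra.
Qed.

Lemma fluctuation_ge k n j w : (j <= n)%N ->
  enorm ((walk Z (k + j) w - (k + j)%:R *: mu) -
         (walk Z k w - k%:R *: mu)) <= fluctuation k n w.
Proof.
move=> jn; have -> : (walk Z (k + j) w - (k + j)%:R *: mu) -
    (walk Z k w - k%:R *: mu) =
    (psum (fun i => x1 (k + i)%N) j w, psum (fun i => x2 (k + i)%N) j w).
  rewrite /walk /psum big_split_ord /= natrD scalerDl opprB addrACA.
  rewrite [- _ - _]addrC.
  elim: j {jn} => [|j IH].
    by rewrite !big_ord0 scale0r; case: (\sum_(i < k) _) (k%:R *: mu) => [a b] [c e];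
      congr pair => /=; ring.
  move: IH; rewrite !big_ord_recr /= -natr1 scalerDl scale1r.
  move: (\sum_(i < k) _) (\sum_(i < j) _) (k%:R *: mu) (j%:R *: mu).
  move=> [a1 a2] [b1 b2] [c1 c2] [d1 d2] [h1 h2]; rewrite -h1 -h2 /x1 /x2.
  by congr pair => /=; ring.
apply: le_trans (enorm_le_normD _) _; rewrite /fluctuation.
by rewrite lerD ?norm_psum_le.
Qed.

Hypothesis iidZ : iid Z.
Hypothesis muE : mu = mean (Z 0%N).
Hypothesis Z2 : ('E_P[fun w => (enorm (Z 0%N w) ^+ 2)%R] < +oo)%E.

Lemma integrable2_component (f : R * R -> R) : measurable_fun setT f ->
  (forall z, `|f z| <= enorm z) -> integrable2 P (f \o Z 0%N).
Proof.
move=> mf fz; have mZ : measurable_fun setT (fun w => enorm (Z 0%N w)).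
  exact: measurable_enorm.
apply: (integrable2_le (g := fun w => enorm (Z 0%N w))).
- exact: measurableT_comp.
- split => //; apply: ge0_integrable1; first exact: measurable_funX.
    by move=> w; exact: sqr_ge0.
  by move: Z2; rewrite unlock.
- by move=> w; exact: fz.
Qed.

Let norm_le_enorm (a b c : R) : c = a ^+ 2 + b ^+ 2 -> `|a| <= Num.sqrt c.
Proof. by move=> ->; rewrite -sqrtr_sqr ler_wsqrtr// lerDl sqr_ge0. Qed.

Lemma integrable2_fst : integrable2 P (fst \o Z 0%N).
Proof.
by apply: integrable2_component => // z; apply: (@norm_le_enorm _ z.2).
Qed.

Lemma integrable2_snd : integrable2 P (snd \o Z 0%N).
Proof.
apply: integrable2_component => // z; apply: (@norm_le_enorm _ z.1).
by rewrite addrC.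
Qed.

(** The four signed coordinates in [fluctuation] and the projection on the direction of [mu1] are
    all instances of this. *)
Lemma centered_iid_dot (v : R * R) : centered_iid P (fun i w => dot (Z i w - mu) v).
Proof.
have mE : mean_real P (fst \o Z 0%N) = mu.1 /\ mean_real P (snd \o Z 0%N) = mu.2.
  by rewrite muE /mean /= unlock.
have [i1 i2] := (integrable2_fst, integrable2_snd).
have j1 := integrable2_1 i1; have j2 := integrable2_1 i2.
have gE : (fun z => dot (z - mu) v) \o Z 0%N =
    (fun w => (v.1 * (fst \o Z 0%N) w + v.2 * (snd \o Z 0%N) w) -
      (v.1 * mu.1 + v.2 * mu.2)).
  by apply/funext => w; rewrite /dot /=; ring.
apply: (iid_centered_iid (g := fun z => dot (z - mu) v)) => //.
- by rewrite /dot; apply: measurable_funD; apply: measurable_funM => //;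
    apply: measurable_funB.
- rewrite gE; apply: integrable2B; last exact: integrable2_cst.
  by apply: integrable2D; exact: integrable2Z.
rewrite gE mean_realB; last 2 first.
- by apply: integrable1D; exact: integrable1Z.
- exact: integrable1_cst.
rewrite mean_realD ?mean_realZ//; [|exact: integrable1Z..].
by rewrite mean_real_cst mE.1 mE.2 subrr.
Qed.

Lemma controlled_fluctuation : controlled P fluctuation.
Proof.
have h (y : nat -> T -> R) v : (forall i w, y i w = dot (Z i w - mu) v) ->
    controlled P (fun k => max_psum (fun i => y (k + i)%N)).
  move=> yE; have -> : y = (fun i w => dot (Z i w - mu) v).
    by apply/funext => i; apply/funext => w; exact: yE.
  exact: (controlled_max_psum (centered_iid_dot v)).
apply: controlledD; apply: controlledD.
- by apply: (h x1 (1, 0)) => i w; rewrite /x1 /dot /=; ring.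
- by apply: (h (fun i => \- x1 i) (-1, 0)) => i w; rewrite /x1 /dot /=; ring.
- by apply: (h x2 (0, 1)) => i w; rewrite /x2 /dot /=; ring.
- by apply: (h (fun i => \- x2 i) (0, -1)) => i w; rewrite /x2 /dot /=; ring.
Qed.

End fluctuations.

(** * Second moment of the excess of the diameter over the projected endpoint *)

Section diameter_excess.
Context {d : measure_display} {T : measurableType d} {R : realType}.
Variables (P : probability T R) (Z1 Z2 : nat -> {RV P >-> (R * R)%type}).
Variables (e mu1 mu2 : R * R) (m m' : R).
Hypothesis mu1E : mu1 = m *: e.
Hypothesis unit_e : dot e e = 1.
Hypothesis mu2_le : enorm mu2 <= m'.
Hypothesis mu12_le : enorm (mu1 - mu2) <= m'.
Hypothesis m'_lt : m' < m.

(** [F 0 n] plays the role of [L_n], and [F (n - r) r] that of the deviation over the last [r]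
    steps. *)
Let F k n w := fluctuation Z1 mu1 k n w + fluctuation Z2 mu2 k n w.

Definition excess n w := hull_diameter Z1 Z2 n w - dot (walk Z1 n w) e.

Let fluctuation_ge0 (Z : nat -> {RV P >-> (R * R)%type}) mu k n w :
  0 <= fluctuation Z mu k n w.
Proof. by rewrite !addr_ge0// max_psum_ge0. Qed.

Let walk0 (Z : nat -> {RV P >-> (R * R)%type}) w : walk Z 0 w = 0.
Proof. by rewrite /walk big_ord0. Qed.

Let fluctuation0_ge (Z : nat -> {RV P >-> (R * R)%type}) mu n j w :
  (j <= n)%N -> enorm (walk Z j w - j%:R *: mu) <= fluctuation Z mu 0 n w.
Proof.
move=> jn; have := fluctuation_ge Z mu 0 w jn.
by rewrite walk0 add0n scale0r !subr0.
Qed.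

Let ML n j w : (j <= n)%N -> enorm (walk Z1 j w - j%:R *: mu1) <= F 0 n w.
Proof.
by move=> jn; rewrite (le_trans (fluctuation0_ge Z1 mu1 w jn))// lerDl.
Qed.

Let NL n j w : (j <= n)%N -> enorm (walk Z2 j w - j%:R *: mu2) <= F 0 n w.
Proof.
by move=> jn; rewrite (le_trans (fluctuation0_ge Z2 mu2 w jn))// lerDr.
Qed.

Lemma excess_ge0 n w : 0 <= excess n w.
Proof.
rewrite subr_ge0.
have [+ _ _] := (hull_diameter_le Z1 Z2 n w _).1 (lexx _) n 0%N (leqnn n) (leq0n n).
rewrite walk0 subr0; apply: le_trans.
have := dot_le_enorm (walk Z1 n w) e.
by rewrite [enorm e]/enorm unit_e sqrtr1 mulr1.
Qed.

Lemma excess_le_crude n w : excess n w <= 3 * F 0 n w.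
Proof.
rewrite lerBlDl; apply/hull_diameter_le.
exact: (pairwise_le_crude_proj mu1E unit_e mu2_le mu12_le m'_lt
  (fun i => @ML n i w) (fun i => @NL n i w)).
Qed.

Lemma excess_le_fine n r eps w : (0 < n)%N -> (r <= n)%N ->
  2 * eps <= m - m' -> F 0 n w <= eps * n%:R ->
  6 * F 0 n w <= (m - m') * r.+1%:R ->
  excess n w <= F 0 r w + 2 * F (n - r) r w + eps / m * F 0 n w.
Proof.
move=> n0 rn h1 h2 h3; rewrite lerBlDl 2!addrA; apply/hull_diameter_le.
apply: (pairwise_le_fine mu1E unit_e mu2_le mu12_le m'_lt n0 rn
  (fun i => @ML n i w) (fun i => @NL n i w)
  (fun i => @ML r i w) (fun i => @NL r i w)) => //.
(* Fluctuations are measured from the start of a window, so the deviation between times [i] and [n]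
   passes through time [n - r]; hence the factor 2. *)
have inc j : (j <= r)%N ->
    enorm ((walk Z1 (n - r + j) w - (n - r + j)%:R *: mu1) -
      (walk Z1 (n - r) w - (n - r)%:R *: mu1)) <= F (n - r) r w.
  by move=> jr; rewrite (le_trans (fluctuation_ge Z1 mu1 _ w jr))// lerDl.
move=> i /andP[ri ni].
have := inc r (leqnn r); rewrite subnK// => hn.
have ir : (i - (n - r) <= r)%N by rewrite leq_subLR subnK.
have := inc _ ir; rewrite subnKC// => hi.
set B := walk Z1 (n - r) w - _ in hn hi.
set X := walk Z1 n w - _; set Y := walk Z1 i w - _.
have -> : X - Y = (X - B) - (Y - B)
  by rewrite [- (Y - B)]opprB (addrA (X - B)) subrK.
by rewrite (le_trans (enormB _ _))// mulr2n mulrDl mul1r lerD.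
Qed.

Hypothesis controlled1 : controlled P (fluctuation Z1 mu1).
Hypothesis controlled2 : controlled P (fluctuation Z2 mu2).

Let FP : controlled P F. Proof. exact: controlledD. Qed.

Lemma measurable_excess n : measurable_fun setT (excess n).
Proof.
apply: measurable_funB; first exact: measurable_hull_diameter.
have mW := measurable_walk Z1 n.
by apply: measurable_funD; apply: measurable_funM => //;
  exact: measurableT_comp.
Qed.

Lemma excess_integrable2 n : integrable2 P (excess n).
Proof.
apply: (integrable2_le (g := fun w => 3 * F 0 n w)).
- exact: measurable_excess.
- exact/integrable2Z/(controlled_integrable2 FP).
- by move=> w; rewrite ger0_norm ?excess_ge0// excess_le_crude.
Qed.

(** Chebyshev's inequality for the second moment. *)
Let exceedance C n eps :
  (forall k n, mean_real P (fun w => F k n w ^+ 2) <= C * n%:R) ->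
  0 < eps -> (0 < n)%N -> measurable [set w | eps * n%:R < F 0 n w] /\
  fine (P [set w | eps * n%:R < F 0 n w]) <= C / eps ^+ 2 / n%:R.
Proof.
move=> hC eps0 n0; have nR0 : 0 < n%:R :> R by rewrite ltr0n.
set A := [set _ | _].
have [mF iF2] := controlled_integrable2 FP 0 n.
have mA : measurable A.
  have -> : A = F 0 n @^-1` `]eps * n%:R, +oo[.
    by apply/seteqP; split => w; rewrite /= in_itv /= andbT.
  by rewrite -[X in measurable X]setTI; exact: mF.
split => //; rewrite -mean_real_indic//.
have iA : integrable1 P (\1_A : T -> R).
  have := integrable1_indic mA (integrable1_cst P 1).
  by apply: eq_integrable => // w _; rewrite /= mul1r.
have le_sqr w : (eps * n%:R) ^+ 2 * \1_A w <= F 0 n w ^+ 2.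
  rewrite indicE; case: (boolP (w \in A)) => [/set_mem /= wA|_] /=.
    rewrite mulr1 lerXn2r// ?nnegrE ?(ltW wA)//; first by rewrite mulr_ge0// ltW.
    exact: controlled_ge0 FP _ _ _.
  by rewrite mulr0 sqr_ge0.
have := le_trans (mean_real_le (integrable1Z _ iA) iF2 le_sqr) (hC 0%N n).
rewrite mean_realZ// => h.
rewrite -(ler_pM2l (x := (eps * n%:R) ^+ 2)) ?exprn_gt0 ?mulr_gt0//.
rewrite (le_trans h)// le_eqVlt; apply/orP; left; apply/eqP.
by field; rewrite !gt_eqF.
Qed.

Lemma mean_excess_sqr eta : 0 < eta -> exists N, forall n, (N <= n)%N ->
  mean_real P (fun w => excess n w ^+ 2) <= eta * n%:R.
Proof.
move=> eta0; have [C C0 hC] := controlled_sqr FP.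
have kappa0 : 0 < m - m' by rewrite subr_gt0.
have m0 : 0 < m by apply: le_lt_trans m'_lt; exact: le_trans (enorm_ge0 _) mu2_le.
(* The terms of [bound] outside [A] have means at most [3 C c n], [12 C c n] and [3 C c n], in all
   at most [3 eta n / 10]; the term on [A] is at most [9 * eta / 36 * n]. *)
pose c := eta / (60 * (C + 1)).
have C1 : 0 < C + 1 by lra.
have c0 : 0 < c by rewrite divr_gt0// mulr_gt0.
have cC : 60 * C * c <= eta.
  rewrite /c mulrA ler_pdivrMr ?mulr_gt0// [leRHS]mulrC ler_wpM2r ?(ltW eta0)//; lra.
pose del := Num.min 1 c.
have del0 : 0 < del by rewrite lt_min ltr01.
have del1 : del <= 1 by rewrite ge_min lexx.
have delc : del <= c by rewrite ge_min lexx orbT.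
(* The first bound gives [(eps / m)^2 <= del <= c]. The second gives
   [6 * eps * n <= (m - m') * del * n], which is below [(m - m') * r.+1] for [r] the integer part of
   [del * n]. *)
pose eps := Num.min (m * del) ((m - m') * del / 6).
have eps0 : 0 < eps by rewrite lt_min !mulr_gt0//= divr_gt0// mulr_gt0.
have epsm : eps <= m * del by rewrite ge_min lexx.
have epsk : eps <= (m - m') * del / 6 by rewrite ge_min lexx orbT.
have [p p0 hp] := controlled_uniform FP (divr_gt0 eta0 (ltr0n R 36)).
(* From [N] on, Chebyshev's bound [C / eps^2 / n] on the probability of [A] is at most [p]. *)
pose N := (Num.truncn (C / eps ^+ 2 / p)).+1.
exists N => n Nn.
have n0 : (0 < n)%N by apply: leq_trans Nn.
have nR0 : 0 < n%:R :> R by rewrite ltr0n.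
pose r := Num.truncn (del * n%:R).
have dn0 : 0 <= del * n%:R by rewrite mulr_ge0// ltW.
have rdn : r%:R <= del * n%:R by rewrite truncn_le.
have rdn' : del * n%:R < r.+1%:R by exact: truncnS_gt.
have rn : (r <= n)%N.
  rewrite -(ler_nat R) (le_trans rdn)// -[leRHS]mul1r ler_wpM2r// ltW.
pose A := [set w | eps * n%:R < F 0 n w].
have [mA PA'] := exceedance hC eps0 n0.
have PA : fine (P A) <= p.
  apply: le_trans PA' _; rewrite ler_pdivrMr// [p * _]mulrC -ler_pdivrMr//.
  by rewrite (le_trans (ltW (truncnS_gt _)))// ler_nat.
have [[_ iA0] [_ ir] [_ is_]] := And3 (controlled_integrable2 FP 0 n)
  (controlled_integrable2 FP 0 r) (controlled_integrable2 FP (n - r) r).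
(* On [A] the crude bound gives [9 F^2]; off [A], the square of the three-term fine bound is at most
   three times the sum of squares. *)
have bound w : excess n w ^+ 2 <=
    (3 * F 0 r w ^+ 2 + 12 * F (n - r) r w ^+ 2) +
    (3 * (eps / m) ^+ 2 * F 0 n w ^+ 2 + 9 * (F 0 n w ^+ 2 * \1_A w)).
  have E0 := excess_ge0 n w.
  have F0 k j : 0 <= F k j w by exact: controlled_ge0 FP _ _ _.
  have em0 : 0 <= (eps / m) ^+ 2 * F 0 n w ^+ 2 by rewrite mulr_ge0 ?sqr_ge0.
  rewrite indicE; case: (boolP (w \in A)) => [/set_mem /= wA|/negP wA] /=.
    have h : excess n w ^+ 2 <= (3 * F 0 n w) ^+ 2.
      by rewrite lerXn2r// ?nnegrE ?mulr_ge0// excess_le_crude.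
    have := sqr_ge0 (F 0 r w); have := sqr_ge0 (F (n - r) r w).
    move: h em0; rewrite exprMn; lra.
  have {}wA : F 0 n w <= eps * n%:R.
    by rewrite leNgt; apply/negP => h; apply: wA; exact/mem_set.
  have h : excess n w <= F 0 r w + 2 * F (n - r) r w + eps / m * F 0 n w.
    apply: excess_le_fine => //.
      apply: (@le_trans _ _ (2 * ((m - m') * del / 6))); first by rewrite ler_wpM2l.
      have := ler_wpM2l (ltW kappa0) del1; lra.
    have h1 : (m - m') * (del * n%:R) <= (m - m') * r.+1%:R.
      by rewrite ler_wpM2l ?(ltW kappa0)// ltW.
    have h2 := ler_wpM2r (ltW nR0) epsk; lra.
  have h' : excess n w ^+ 2 <=
      (F 0 r w + 2 * F (n - r) r w + eps / m * F 0 n w) ^+ 2.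
    by rewrite lerXn2r// ?nnegrE// (le_trans E0).
  rewrite mulr0 mulr0 addr0 (le_trans h')//.
  move: (F 0 r w) (F (n - r) r w) (F 0 n w) (eps / m) => u v y z.
  have := sqr_ge0 (u - 2 * v); have := sqr_ge0 (u - z * y).
  have := sqr_ge0 (2 * v - z * y); lra.
have iA := integrable1_indic mA iA0.
apply: le_trans (mean_real_le (proj2 (excess_integrable2 n)) _ bound) _.
  by do 2!apply: integrable1D; exact: integrable1Z.
rewrite mean_realD; [|by apply: integrable1D; exact: integrable1Z..].
rewrite !mean_realD ?mean_realZ//; [|exact: integrable1Z..].
have b1 := hC 0%N r; have b2 := hC (n - r)%N r.
have b3 : 3 * (eps / m) ^+ 2 * mean_real P (fun w => F 0 n w ^+ 2) <=
    3 * c * (C * n%:R).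
  have y0 : 0 <= mean_real P (fun w => F 0 n w ^+ 2).
    by apply: mean_real_ge0 => w; exact: sqr_ge0.
  have y1 : 0 <= 3 * (eps / m) ^+ 2 by rewrite mulr_ge0// sqr_ge0.
  apply: (ler_pM y1 y0) => //; rewrite ler_wpM2l//.
  have z1 : eps / m <= del by rewrite ler_pdivrMr// mulrC.
  have z0 : 0 <= eps / m by rewrite divr_ge0// ltW.
  rewrite (le_trans _ delc)// expr2 -[leRHS]mulr1 ler_pM//.
  exact: le_trans z1 del1.
have b4 := hp n A mA PA.
have b5 : C * r%:R <= C * (c * n%:R).
  rewrite ler_wpM2l// (le_trans rdn)// ler_wpM2r// ltW//.
have b6 := ler_wpM2r (ltW nR0) cC.
have b7 : 0 < eta * n%:R by rewrite mulr_gt0.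
lra.
Qed.

End diameter_excess.

(** * The variance of the diameter *)

Section variance_perturbation.
Context {d : measure_display} {T : measurableType d} {R : realType}.
Variable P : probability T R.

Lemma variance_mean_real (X : T -> R) : integrable2 P X ->
  ('V_P[X] = (mean_real P (fun w => (X w - mean_real P X) ^+ 2))%:E)%E.
Proof.
move=> iX; have [_ i2] := integrable2B iX (integrable2_cst P (mean_real P X)).
rewrite -mean_realE// /variance covariance.unlock expectation.unlock.
by apply: eq_integral => w _.
Qed.

Lemma mean_real_centered_sqr (Y : T -> R) : integrable2 P Y ->
  mean_real P (fun w => (Y w - mean_real P Y) ^+ 2) <=
  mean_real P (fun w => Y w ^+ 2).
Proof.
move=> iY; set y := mean_real P Y; have i1 := integrable2_1 iY.
have -> : (fun w => (Y w - y) ^+ 2) =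
    (fun w => Y w ^+ 2 - ((2 * y) * Y w - y ^+ 2)).
  by apply/funext => w; ring.
have i3 : integrable1 P (fun w => (2 * y) * Y w - y ^+ 2).
  by apply: integrable1B; [exact: integrable1Z | exact: integrable1_cst].
rewrite mean_realB//; last by case: iY.
rewrite mean_realB; [|exact: integrable1Z|exact: integrable1_cst].
rewrite mean_realZ// mean_real_cst.
by rewrite -/y; have := sqr_ge0 y; nra.
Qed.

(** The variance is the second moment of [X] plus the centered [Y]. Weighting the cross term by [t]
    puts only a small multiple of the moment of [X] in the error, while [t^-1] falls on [Y]. The
    witness [v] expresses that the variance is finite. *)
Lemma variance_perturbation (X Y : T -> R) (c t : R) :
  integrable2 P X -> integrable2 P Y -> mean_real P X = 0 -> 0 < t ->
  exists v, 'V_P[fun w => (c + X w + Y w)%R]%E = v%:E /\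
    `|v - mean_real P (fun w => X w ^+ 2)| <=
    t * mean_real P (fun w => X w ^+ 2) +
    (1 + t^-1) * mean_real P (fun w => Y w ^+ 2).
Proof.
move=> iX iY X0 t0; set y := mean_real P Y.
have iY' := integrable2B iY (integrable2_cst P y).
have icX := integrable2D (integrable2_cst P c) iX.
have meanE : mean_real P (fun w => c + X w + Y w) = c + y.
  rewrite !mean_realD//; do ?[exact: integrable2_1 | exact: integrable1_cst].
    by rewrite X0 mean_real_cst addr0.
have iZ := integrable2D icX iY.
exists (mean_real P (fun w => (X w + (Y w - y)) ^+ 2)); split.
  rewrite variance_mean_real// meanE; congr (_%:E); congr mean_real.
  by apply/funext => w; congr (_ ^+ 2); ring.
have [[_ jX] [_ jY] [_ jS]] := And3 iX iY' (integrable2D iX iY').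
have it r s : integrable1 P (fun w => r * X w ^+ 2 + s * (Y w - y) ^+ 2).
  by apply: integrable1D; exact: integrable1Z.
have mt r s : mean_real P (fun w => r * X w ^+ 2 + s * (Y w - y) ^+ 2) =
    r * mean_real P (fun w => X w ^+ 2) +
    s * mean_real P (fun w => (Y w - y) ^+ 2).
  rewrite mean_realD ?mean_realZ//; exact: integrable1Z.
have t1 : 0 < t^-1 by rewrite invr_gt0.
have tt : t^-1 * t = 1 by rewrite mulVf// gt_eqF.
(* Young: [2 |a b| <= t a^2 + b^2 / t] *)
have young (a b : R) : 2 * a * b <= t * a ^+ 2 + t^-1 * b ^+ 2.
  have -> : t * a ^+ 2 + t^-1 * b ^+ 2 = 2 * a * b + t^-1 * (t * a - b) ^+ 2.
    by field; rewrite gt_eqF.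
  by rewrite lerDl mulr_ge0 ?sqr_ge0// ltW.
have up : mean_real P (fun w => (X w + (Y w - y)) ^+ 2) <=
    (1 + t) * mean_real P (fun w => X w ^+ 2) +
    (1 + t^-1) * mean_real P (fun w => (Y w - y) ^+ 2).
  rewrite -mt; apply: mean_real_le => // w.
  by have := young (X w) (Y w - y); rewrite sqrrD; lra.
have low : (1 - t) * mean_real P (fun w => X w ^+ 2) +
    (1 - t^-1) * mean_real P (fun w => (Y w - y) ^+ 2) <=
    mean_real P (fun w => (X w + (Y w - y)) ^+ 2).
  rewrite -mt; apply: mean_real_le => // w.
  by have := young (X w) (- (Y w - y)); rewrite sqrrN sqrrD; lra.
have hY := mean_real_centered_sqr iY; rewrite -/y in hY.
have pY : 0 <= mean_real P (fun w => (Y w - y) ^+ 2).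
  by apply: mean_real_ge0 => w; exact: sqr_ge0.
have hY' := ler_wpM2l (ltW t1) hY.
have pY' := mulr_ge0 (ltW t1) pY.
by rewrite ler_norml; apply/andP; split; lra.
Qed.

End variance_perturbation.

(** * Convergence of the normalized variance *)

Theorem theorem2p5 (d : measure_display) (T : measurableType d) (R : realType)
    (P : probability T R) (Z1 Z2 : nat -> {RV P >-> (R * R)%type})
    (iid1 : iid Z1) (iid2 : iid Z2) (indep12 : independent_families Z1 Z2)
    (square_integrable1 : ('E_P[fun w => (enorm (Z1 0%N w) ^+ 2)%R] < +oo)%E)
    (square_integrable2 : ('E_P[fun w => (enorm (Z2 0%N w) ^+ 2)%R] < +oo)%E)
    (mu1 mu2 : R * R) (mu1E : mu1 = mean (Z1 0%N)) (mu2E : mu2 = mean (Z2 0%N))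
    (nonzero : 0 \notin [:: mu1; mu2; mu1 - mu2])
    (maximal : Num.max (enorm mu2) (enorm (mu1 - mu2)) < enorm mu1)
    (theta1 : R) (theta1_range : 0 <= theta1 < 2 * pi)
    (theta1E : mu1 = enorm mu1 *: unit_vector theta1)
    (sigma2 : \bar R)
    (sigma2E : sigma2 =
      'E_P[fun w => (dot (Z1 0%N w - mu1) (unit_vector theta1) ^+ 2)%R]%E) :
  ('V_P[hull_diameter Z1 Z2 n] / n%:R%:E)%E @[n --> \oo] --> sigma2 /\
  (0 <= sigma2 < +oo)%E.
Proof.
set e := unit_vector theta1 in theta1E sigma2E *.
have unit_e : dot e e = 1 by rewrite /dot /= -!expr2 cos2Dsin2.
set m' := Num.max _ _ in maximal.
have mu2_le : enorm mu2 <= m' by rewrite le_max lexx.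
have mu12_le : enorm (mu1 - mu2) <= m' by rewrite le_max lexx orbT.
have F1 := controlled_fluctuation iid1 mu1E square_integrable1.
have F2 := controlled_fluctuation iid2 mu2E square_integrable2.
pose x i w := dot (Z1 i w - mu1) e.
have xP : centered_iid P x := centered_iid_dot iid1 mu1E square_integrable1 e.
set V := step_variance P x.
have V0 : 0 <= V by exact: step_variance_ge0.
have sV : sigma2 = V%:E.
  rewrite sigma2E expectation.unlock.
  by rewrite (mean_realE (proj2 (centered_iid_integrable2 xP))).
pose Y := excess Z1 Z2 e.
(* The diameter is a constant plus the centered projected walk, of variance [n V], plus the excess,
   negligible in mean square. *)
have DE n : hull_diameter Z1 Z2 n =
    (fun w => n%:R * dot mu1 e + psum x n w + Y n w).
  apply/funext => w; rewrite /Y /excess.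
  suff -> : dot (walk Z1 n w) e = n%:R * dot mu1 e + psum x n w by ring.
  rewrite /walk /psum; elim: n => [|n IH].
    by rewrite !big_ord0 /dot /=; ring.
  rewrite !big_ord_recr /= -natr1.
  have -> : dot (\sum_(i < n) Z1 i w + Z1 n w) e =
      dot (\sum_(i < n) Z1 i w) e + dot (Z1 n w) e by rewrite /dot /=; ring.
  by rewrite IH /x /dot /=; ring.
have mean_psum n : mean_real P (psum x n) = 0.
  rewrite /psum (mean_real_sum (F := x)); last first.
    by move=> i _; exact/integrable2_1/integrable2_step.
  by rewrite big1// => i _; exact: (mean_step xP).
have iY n : integrable2 P (Y n) :=
  excess_integrable2 theta1E unit_e mu2_le mu12_le maximal F1 F2 n.
have key eta : 0 < eta -> exists N, forall n, (N <= n)%N -> exists2 v,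
    ('V_P[hull_diameter Z1 Z2 n] / n%:R%:E)%E = v%:E & `|V - v| <= eta.
  (* [t] makes the error [t * V] at most [eta / 2], with [V + 1] guarding against [V = 0]; [s] is
     then such that [(1 + t^-1) * s = eta / 2]. *)
  move=> eta0; pose t := eta / (2 * (V + 1)).
  have V1 : 0 < V + 1 by lra.
  have t0 : 0 < t by rewrite divr_gt0// mulr_gt0.
  have t1 : 0 < t^-1 by rewrite invr_gt0.
  have tV : t * V <= eta / 2.
    by rewrite /t invfM mulrA mulrAC ler_pdivrMr// ler_wpM2l ?divr_ge0 ?ltW//; lra.
  pose s := eta / 2 / (1 + t^-1).
  have s0 : 0 < s by rewrite !divr_gt0// addr_gt0.
  have [N hN] := mean_excess_sqr theta1E unit_e mu2_le mu12_le maximal F1 F2 s0.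
  (* The successor excludes [n = 0], where the quotient by [n] is meaningless. *)
  exists N.+1 => n Nn; have n0 : 0 < n%:R :> R.
    by rewrite ltr0n (leq_trans _ Nn).
  have [v [vE hv]] := variance_perturbation (n%:R * dot mu1 e)
    (psum_integrable2 xP n) (iY n) (mean_psum n) t0.
  exists (v / n%:R).
    by rewrite DE vE inver gt_eqF// -EFinM.
  have hs : (1 + t^-1) * mean_real P (fun w => Y n w ^+ 2) <= eta / 2 * n%:R.
    have -> : eta / 2 * n%:R = (1 + t^-1) * (s * n%:R).
      by rewrite /s; field; rewrite !gt_eqF ?addr_gt0.
    by rewrite ler_wpM2l ?addr_ge0 ?(ltW t1)// hN// ltnW.
  rewrite (mean_psum_sqr xP) -/V in hv.
  have -> : V - v / n%:R = (n%:R * V - v) / n%:R.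
    by field; rewrite gt_eqF.
  rewrite normrM normfV (gtr0_norm n0) ler_pdivrMr// distrC (le_trans hv)//.
  have := ler_wpM2r (ltW n0) tV; lra.
split; last by rewrite sV lee_fin V0 ltry.
rewrite sV; apply/fine_cvgP; split.
  (* Convergence to a finite limit requires values that are eventually finite; any [eta] provides
     this. *)
  have [N hN] := key 1 ltr01.
  by exists N => // n /= /hN [v -> _].
apply/cvgrPdist_le => eta eta0; have [N hN] := key _ eta0.
by exists N => // n /= /hN [v /= -> ].
Qed.
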